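(* Let $\mu$ be a probability measure on $X$, let $\alpha$ be a Young function satisfying the $\Delta_2$-condition, and let $p_\alpha=\sup_{x>0}\frac{x\alpha'_+(x)}{\alpha(x)}>1$. Assume that $\mu$ satisfies $\mathbf{T}_\alpha(C)$ for some constant $C>0$. Then, for any bounded measurable function $\varphi:X\to\mathbb{R}$, the probability measure $d\tilde\mu=\frac1Z e^{\varphi}\,d\mu$ (where $Z=\int e^\varphi\,d\mu$ is the normalization constant) satisfies $\mathbf{T}_\alpha(\widetilde C)$ with $$\widetilde C=\widetilde\kappa_{p_\alpha}\,C\,e^{(p_\alpha-1)\mathrm{Osc}(\varphi)},$$ where $\mathrm{Osc}(\varphi)=\sup\varphi-\inf\varphi$ and $\widetilde\kappa_{p_\alpha}=\frac{p_\alpha^{p_\alpha^2}}{(p_\alpha-1)^{p_\alpha(p_\alpha-1)}}$.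
   Context: Throughout, $(X,d)$ is a complete separable metric space whose closed balls are compact; measures are Borel. A Young function is an even convex function $\alpha:\mathbb{R}\to\mathbb{R}^+$ (finite valued), increasing on $\mathbb{R}^+$, with $\alpha(0)=0$ and $\alpha'(0)=0$. It satisfies the $\Delta_2$-condition if there is a constant $K>0$ with $\alpha(2x)\le K\alpha(x)$ for all $x\in\mathbb{R}$. $\alpha'_+$ denotes the right derivative. Optimal transport cost: $\mathcal{T}_\alpha(\nu,\mu)=\inf_\pi\iint\alpha(d(x,y))\,d\pi(x,y)$, the infimum being over all probability measures $\pi$ on $X\times X$ with marginals $\nu$ and $\mu$. Relative entropy: $H(\nu|\mu)=\int\log\frac{d\nu}{d\mu}\,d\nu$ if $\nu\ll\mu$, and $+\infty$ otherwise. $\mu$ satisfies $\mathbf{T}_\alpha(C)$ if $\mathcal{T}_\alpha(\nu,\mu)\le C\,H(\nu|\mu)$ for all probability measures $\nu$ on $X$. *)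

(* Defs.v *)
From HB Require Import structures.
From mathcomp Require Import all_boot all_order all_algebra.
From mathcomp Require Import all_classical all_reals all_analysis.
From mathcomp Require Import measurable_realfun.

Set Implicit Arguments.
Unset Strict Implicit.
Unset Printing Implicit Defensive.

Import Order.TTheory GRing.Theory Num.Theory.
Import numFieldNormedType.Exports.

Local Open Scope classical_set_scope.
Local Open Scope ring_scope.

(* [CompletePseudoMetric] brings a distinguished point; a space that carries a
   probability measure is nonempty, so this is no restriction. *)
#[short(type="completeMetricType")]
HB.structure Definition CompleteMetric (R : numDomainType) :=
  {T of CompletePseudoMetric R T & PseudoMetric_isMetric R T}.

Definition separable (T : topologicalType) :=
  exists2 D : set T, countable D & dense D.

(* Closed balls are [{y | d(x, y) <= r}]; the library's [closed_ball] is the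
   closure of the open ball, which can be smaller in a general metric space. *)
Definition compact_closed_balls (R : realType) (X : completeMetricType R) :=
  forall (x : X) (r : R), compact [set y : X | mdist x y <= r].

Notation borel X := (g_sigma_algebraType (@open X)).

Section young.
Context {R : realType}.
Implicit Types alpha : R -> R.

(* "Increasing on R^+" is taken in the wide sense. It is automatically strict when
   [Delta2 alpha] holds and alpha is not identically zero. *)
Record young_function alpha : Prop := {
  young_ge0 : forall x, 0 <= alpha x ;
  young_even : forall x, alpha (- x) = alpha x ;
  young_convex : @convex_function R R^o setT alpha ;
  young_ndecr : {in `[0, +oo[ &, {homo alpha : x y / x <= y}} ;
  young0 : alpha 0 = 0 ;
  young_derive0 : is_derive (0 : R) (1 : R) (alpha : R -> R^o) 0 }.

Definition Delta2 alpha :=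
  exists2 K : R, 0 < K & forall x, alpha (2 * x) <= K * alpha x.

Definition right_derive alpha (x : R) : R :=
  lim (h^-1 * (alpha (x + h) - alpha x) @[h --> 0^'+]).

(* The Delta2-condition makes this set bounded above: x * alpha'_+(x) is at most
   alpha (2 * x) - alpha x. Hence the real-valued [sup] is the genuine supremum
   in the presence of [Delta2 alpha]. *)
Definition p_exponent alpha : R :=
  sup [set x * right_derive alpha x / alpha x | x in [set x : R | 0 < x]].

End young.

Section transport.
Context {R : realType} {X : completeMetricType R}.
Implicit Types (mu nu : probability (borel X) R) (alpha : R -> R).

Local Open Scope ereal_scope.

(* [borel X * borel X] carries the product sigma-algebra, which is the Borel
   sigma-algebra of [X * X] when X is separable. *)
Definition coupling nu mu (pi : probability (borel X * borel X)%type R) :=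
  forall A : set (borel X), measurable A ->
    pi (A `*` setT) = nu A /\ pi (setT `*` A) = mu A.

Definition transport_cost alpha nu mu : \bar R :=
  ereal_inf [set \int[pi]_z (alpha (mdist (z.1 : X) (z.2 : X)))%:E
            | pi in coupling nu mu].

Definition relative_entropy nu mu : \bar R :=
  if `[< nu `<< mu >]
  then \int[nu]_x lne (Radon_Nikodym (charge_of_finite_measure nu) mu x)
  else +oo.

Definition transport_entropy alpha (C : R) mu :=
  forall nu, transport_cost alpha nu mu <= C%:E * relative_entropy nu mu.

End transport.

Section tilt.
Context {R : realType} {X : completeMetricType R}.
Variables (mu : probability (borel X) R) (phi : {mfun borel X >-> R}).

Local Open Scope ereal_scope.

Definition exp_density (A : set (borel X)) : \bar R :=
  \int[mu]_(x in A) (expR (phi x))%:E.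

Let exp_density0 : exp_density set0 = 0.
Proof. exact: integral_set0. Qed.

Let exp_density_ge0 A : 0 <= exp_density A.
Proof. by apply: integral_ge0 => x _; rewrite lee_fin expR_ge0. Qed.

Let exp_density_sigma_additive : semi_sigma_additive exp_density.
Proof.
apply: semi_sigma_additive_nng_induced => [|x]; last by rewrite lee_fin expR_ge0.
by apply/measurable_EFinP; exact: measurableT_comp.
Qed.

HB.instance Definition _ := isMeasure.Build _ _ _ exp_density
  exp_density0 exp_density_ge0 exp_density_sigma_additive.

Definition tilt : probability (borel X) R := mnormalize exp_density mu.

(* The fallback value [mu] of [mnormalize] is never used when phi is bounded. *)
Lemma tiltE (A : set (borel X)) : bounded_fun (phi : borel X -> R^o) ->
  let Z := (\int[mu]_x expR (phi x))%R in
  tilt A = Z^-1%:E * \int[mu]_(x in A) (expR (phi x))%:E.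
Proof.
move=> bphi Z; set E := \int[mu]_x (expR (phi x))%:E.
have [M0 phiM] : exists M : R, forall x, (`|phi x| <= M)%R.
  have [M [_ HM]] := bphi; exists (M + 1)%R => x.
  by apply: (HM (M + 1)%R _ x I); rewrite ltrDl.
have mexp : measurable_fun setT (fun x => expR (phi x)) by exact: measurableT_comp.
have mu1 : mu setT = 1 by exact: probability_setT.
have E_lo : (expR (- M0))%:E <= E.
  have <- : \int[mu]_x (expR (- M0))%:E = (expR (- M0))%:E.
    by rewrite integral_cst// [X in _ * X]mu1 mule1.
  apply: ge0_le_integral => //; first exact/measurable_EFinP.
  move=> x _; rewrite lee_fin ler_expR.
  by have := phiM x; rewrite ler_norml => /andP[].
have E_up : E <= (expR M0)%:E.
  have <- : \int[mu]_x (expR M0)%:E = (expR M0)%:E.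
    by rewrite integral_cst// [X in _ * X]mu1 mule1.
  apply: ge0_le_integral => //; first exact/measurable_EFinP.
  move=> x _; rewrite lee_fin ler_expR.
  by have := phiM x; rewrite ler_norml => /andP[].
have E_neq0 : E != 0.
  by rewrite gt_eqF// (lt_le_trans _ E_lo)// lte_fin expR_gt0.
have E_neqoo : E != +oo by rewrite lt_eqF// (le_lt_trans E_up)// ltry.
rewrite /tilt /= /mnormalize /exp_density -/E.
by rewrite (negbTE E_neq0) (negbTE E_neqoo) /= muleC.
Qed.

End tilt.

Definition Osc (R : realType) (T : Type) (phi : T -> R) : R :=
  sup (range phi) - inf (range phi).

Definition kappa (R : realType) (p : R) : R :=
  p `^ (p ^+ 2) / (p - 1) `^ (p * (p - 1)).

(* Main.v *)
(* Write [p] for the exponent of [alpha] and [q = p - 1]. If [nu] has density [e^w / Z] with respect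
   to [mu], an optimal transport of [nu] to [mu] bounds the entropy of [nu], so that the transport
   inequality yields a logarithmic Sobolev inequality in which the bound
   [w x - w y <= psi x + L alpha(d(x, y))] plays the role of a gradient bound. The Holley-Stroock
   argument carries it over to the perturbed measure, at the price of the factor [e^Osc]. To come
   back, take the sup-convolutions [h_l x = sup_y (f y - l alpha(d(x, y)))]. Since
   [alpha (t x) <= t^p alpha x] for [t >= 1], the logarithmic Sobolev inequality makes
   [(1/k) ln \int e^(k h_l)] nondecreasing when [y] decreases along the curve [k = L y^q],
   [l = (1 - B y)^-q]. Comparing a value [y1] with the limit as [y] tends to 0 gives
   [\int e^(k1 f) <= e^(k1 \int g)] whenever [f x - g y <= alpha(d(x, y))]. By Kantorovich duality
   and Gibbs' variational principle this is the transport inequality with constant [1 / k1], and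
   the choice [L = 1 / (p C)], [y1 = e1 / (1 + B e1)], [e1 = 1 / p] gives the announced constant. *)

From HB Require Import structures.
Require Import Defs.
From mathcomp Require Import all_boot all_order all_algebra.
From mathcomp Require Import all_classical all_reals all_analysis.
From mathcomp Require Import measurable_realfun.
From mathcomp Require Import ring lra.

Set Implicit Arguments.
Unset Strict Implicit.
Unset Printing Implicit Defensive.

Import Order.TTheory GRing.Theory Num.Theory.
Import numFieldNormedType.Exports.

Local Open Scope classical_set_scope.
Local Open Scope ring_scope.

(** * Growth of Young functions *)

(** The curve meets two requirements at once. Put [B = A b] and [e = y / (1 - B y)]. The cost enters
    the increments of [k h_l] with coefficient [k l e^-q], which must equal [L]; the entropy
    produced by a change of [k] is absorbed by the decrease of [h_l] when [d ln l = B e d ln k].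
    Both hold identically on the curve. Replacing [(1 - e)^-q - 1] by a chord [b e] makes the second
    equation explicitly solvable. No derivative in [l] is taken: a maximiser of the sup-convolution
    need not exist, so every infinitesimal statement becomes a finite step with a quadratic error.
    The parameters are optimal for the bound that is kept. Since [A >= 1], [k1] is at least
    [L ((1 - L C) e^-Osc e1 (1 - e1)^q)^q]; [L = 1 / (p C)] maximises [L (1 - L C)^q] and
    [e1 = 1 / p] maximises [e1 (1 - e1)^q]. Kantorovich duality is obtained from finite linear
    programming on a partition of a large ball. This requires finite integrals of [alpha(d(x, x0))]:
    for [mu] they follow from the transport inequality, for the perturbed measure from its bounded
    density, for [nu] from finite entropy. *)

(** Over [n] equal pieces the errors add up to [D (b - a)^2 / n], which tends to 0. This replaces
    the integration of a derivative of known sign, both for the growth of [alpha] and along the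
    curve of sup-convolutions; no regularity of [F] is involved. *)
Lemma le_of_quadratic_drop (R : realType) (F : R -> R) (a b D e : R) :
  a <= b -> 0 < e ->
  (forall s t, a <= s -> s <= t -> t <= b -> t - s <= e ->
    F s <= F t + D * (t - s) ^+ 2) ->
  F a <= F b.
Proof.
move=> ab e0 H; apply/ler_addgt0Pr => c c0.
(* The first two terms make the mesh at most [e] and the total error at most [c]; the [+ 1] makes
   [n] positive. *)
have [n nlt] : exists n : nat, ((b - a) / e + `|D| * (b - a) ^+ 2 / c) + 1 <= n%:R.
  by exists (Num.truncn ((b - a) / e + `|D| * (b - a) ^+ 2 / c + 1)).+1; exact/ltW/truncnS_gt.
have t1 : 0 <= (b - a) / e by rewrite divr_ge0 ?subr_ge0// ltW.
have t2 : 0 <= `|D| * (b - a) ^+ 2 / c.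
  by apply: divr_ge0; [rewrite mulr_ge0// exprn_ge0// subr_ge0|exact: ltW].
have n0 : 0 < n%:R :> R by apply: lt_le_trans nlt; lra.
have n_neq0 : n%:R != 0 :> R by rewrite gt_eqF.
pose d := (b - a) / n%:R.
have d0 : 0 <= d by rewrite divr_ge0 ?subr_ge0// ltW.
have de : d <= e.
  rewrite ler_pdivrMr// mulrC -ler_pdivrMr//; apply: le_trans nlt; lra.
have nd : n%:R * d = b - a by rewrite /d mulrC divfK.
have step k : (k <= n)%N -> F a <= F (a + k%:R * d) + k%:R * (D * d ^+ 2).
  elim: k => [_|k IH kn]; first by rewrite mul0r !addr0 mul0r addr0.
  have Fk := IH (ltnW kn).
  have := H (a + k%:R * d) (a + k.+1%:R * d).
  have -> : a + k.+1%:R * d - (a + k%:R * d) = d by rewrite -natr1; ring.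
  move=> Hk; apply: le_trans Fk _.
  have : F (a + k%:R * d) <= F (a + k.+1%:R * d) + D * d ^+ 2.
    apply: Hk => //.
    - by rewrite lerDl mulr_ge0.
    - by rewrite lerD2l ler_wpM2r// ler_nat.
    - rewrite -lerBrDl -nd; apply: ler_wpM2r => //.
      by rewrite ler_nat.
  rewrite -natr1; lra.
have := step n (leqnn _); rewrite nd (addrC a) subrK => /le_trans; apply.
rewrite lerD2l.
have -> : n%:R * (D * d ^+ 2) = D * (b - a) ^+ 2 / n%:R.
  by rewrite /d; field.
rewrite ler_pdivrMr// -ler_pdivrMl// [c^-1 * _]mulrC.
have : D * (b - a) ^+ 2 / c <= `|D| * (b - a) ^+ 2 / c.
  apply: ler_wpM2r; first by rewrite invr_ge0 ltW.
  by apply: ler_wpM2r; [rewrite exprn_ge0// subr_ge0|exact: ler_norm].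
move: nlt t1 t2; lra.
Qed.

Section young.
Context {R : realType} (alpha : R -> R).
Hypothesis Ya : young_function alpha.

Lemma young_conv (t x y : R) : 0 <= t -> t <= 1 ->
  alpha (t * x + (1 - t) * y) <= t * alpha x + (1 - t) * alpha y.
Proof.
move=> t0 t1.
have t01 : t \in `[0, 1] by rewrite in_itv /= t0 t1.
pose s : {i01 R} := Itv01 t0 t1.
by have := @young_convex _ _ Ya s x y; rewrite !inE => /(_ I I).
Qed.

(** Convexity multiplied out: without a division, coinciding points are allowed and comparisons of
    slopes become linear. *)
Lemma young_three_points (a b c : R) : a <= b -> b <= c ->
  (c - a) * alpha b <= (c - b) * alpha a + (b - a) * alpha c.
Proof.
move=> ab bc; have [ac|ac] := ltP a c; last first.
  have -> : b = a by apply: le_anti; rewrite ab (le_trans bc).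
  have -> : c = a by apply: le_anti; rewrite ac (le_trans ab).
  by lra.
have ca0 : 0 < c - a by rewrite subr_gt0.
have ca_neq0 : c - a != 0 by rewrite gt_eqF.
have := @young_conv ((c - b) / (c - a)) a c.
have -> : (c - b) / (c - a) * a + (1 - (c - b) / (c - a)) * c = b by field.
have -> : (c - b) / (c - a) * alpha a + (1 - (c - b) / (c - a)) * alpha c
   = ((c - b) * alpha a + (b - a) * alpha c) / (c - a) by field.
move=> H; rewrite mulrC -ler_pdivlMr//; apply: H.
  by rewrite divr_ge0// subr_ge0// ltW.
by rewrite ler_pdivrMr// mul1r lerB.
Qed.

Let slope (x h : R) := h^-1 * (alpha (x + h) - alpha x).

Lemma young_slope_homo x h k : 0 < h -> h <= k -> slope x h <= slope x k.
Proof.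
move=> h0 hk; have k0 : 0 < k := lt_le_trans h0 hk.
rewrite /slope [k^-1 * _]mulrC ler_pdivlMr// -mulrA ler_pdivrMl//.
have := @young_three_points x (x + h) (x + k).
rewrite lerDl ltW// lerD2l => /(_ isT hk); lra.
Qed.

Lemma young_slope_ge x y h : x < y -> 0 < h ->
  (alpha y - alpha x) / (y - x) <= slope y h.
Proof.
move=> xy h0; have yx0 : 0 < y - x by rewrite subr_gt0.
rewrite /slope ler_pdivrMr// -mulrA ler_pdivlMl//.
have := @young_three_points x y (y + h).
rewrite lerDl ltW// ltW// => /(_ isT isT); lra.
Qed.

(** Slopes from [x] increase with the increment and are bounded below by a slope on the left of [x];
    hence the one-sided limit exists and [lim] has its intended value. *)
Lemma right_deriveE x : right_derive alpha x = inf (slope x @` [set h | 0 < h]).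
Proof.
rewrite /right_derive; apply: cvg_lim => //.
have -> : [set h : R | 0 < h] = [set` Interval (BRight 0) (BInfty R false)].
  by apply/seteqP; split => h /=; rewrite in_itv/= andbT.
apply: (@nondecreasing_at_right_cvgr R (slope x)) => //.
  by move=> h k; rewrite !in_itv/= !andbT => h0 k0 hk; exact: young_slope_homo.
exists ((alpha x - alpha (x - 1)) / (x - (x - 1))) => z [h /= + <-].
rewrite in_itv/= andbT => h0; apply: young_slope_ge => //.
by rewrite ltrBlDr ltrDl.
Qed.

Lemma right_derive_ge x y : x < y ->
  (alpha y - alpha x) / (y - x) <= right_derive alpha y.
Proof.
move=> xy; rewrite right_deriveE; apply: lb_le_inf; first by exists (slope y 1), 1 => /=.
by move=> _ [h h0 <-]; exact: young_slope_ge.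
Qed.

Lemma right_derive_le x h : 0 < h -> right_derive alpha x <= slope x h.
Proof.
move=> h0; rewrite right_deriveE; apply: ge_inf; last by exists h.
exists ((alpha x - alpha (x - 1)) / (x - (x - 1))) => _ [k k0 <-].
by apply: young_slope_ge => //; rewrite ltrBlDr ltrDl.
Qed.

Lemma young_homo x y : 0 <= x -> x <= y -> alpha x <= alpha y.
Proof.
move=> x0 xy; apply: (young_ndecr Ya) => //; rewrite in_itv/= andbT//.
exact: le_trans xy.
Qed.

Hypothesis D2 : Delta2 alpha.
Let p := p_exponent alpha.
Hypothesis p1 : 1 < p.

(** A zero at [x > 0] spreads by [Delta2] to every [2^n x], hence by monotonicity to all of [R^+].
    Each quotient in [p_exponent] is then [0], by the convention on division by zero, so that
    [p = 0], against [1 < p]. *)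
Lemma young_gt0 x : 0 < x -> 0 < alpha x.
Proof.
move=> x0; rewrite lt_neqAle (young_ge0 Ya) andbT eq_sym; apply/eqP => ax0.
have [K K0 KD] := D2.
have pow n : alpha (2 ^+ n * x) = 0.
  elim: n => [|n IH]; first by rewrite expr0 mul1r.
  apply/eqP; rewrite eq_le (young_ge0 Ya) andbT exprS -mulrA.
  by rewrite (le_trans (KD _))// IH mulr0.
have az y : 0 <= y -> alpha y = 0.
  move=> y0; have [n yn] : exists n : nat, y / x <= n%:R.
    by exists (Num.truncn (y / x)).+1; exact/ltW/truncnS_gt.
  apply/eqP; rewrite eq_le (young_ge0 Ya) andbT -(pow n).
  apply: young_homo => //; rewrite -ler_pdivrMr// (le_trans yn)//.
  by rewrite -natrX ler_nat ltnW// ltn_expl.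
suff : p <= 0 by move: p1; lra.
rewrite /p /p_exponent.
rewrite [X in sup X](_ : _ = [set 0]) ?sup1//; apply/seteqP; split => [_ [y /= y0 <-]|_ ->] /=.
  by rewrite (az _ (ltW y0)) invr0 mulr0.
by exists 1 => /=; rewrite ?ltr01// (az _ ler01) invr0 mulr0.
Qed.

Lemma right_derive_le_p y : 0 < y -> y * right_derive alpha y <= p * alpha y.
Proof.
move=> y0; rewrite -ler_pdivrMr ?young_gt0//; apply: ub_le_sup; last by exists y.
have [K K0 KD] := D2.
exists K => _ [x /= x0 <-]; rewrite ler_pdivrMr ?young_gt0//.
have := @right_derive_le x x x0; rewrite /slope ler_pdivlMl// => /le_trans; apply.
have := KD x; rewrite (_ : 2 * x = x + x); last by ring.
have := young_ge0 Ya x; lra.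
Qed.

(** The chord over [[(1 - s) y, y]] has slope at most the right derivative at [y], itself at most
    [p alpha(y) / y]. *)
Lemma young_contract_ge y s : 0 <= y -> 0 <= s -> s <= 1 ->
  (1 - p * s) * alpha y <= alpha ((1 - s) * y).
Proof.
rewrite le_eqVlt => /orP[/eqP <- s0 s1|y0].
  by rewrite mulr0 young0// mulr0.
rewrite le_eqVlt => /orP[/eqP <- s1|s0 s1].
  by rewrite mulr0 subr0 !mul1r.
have lt : (1 - s) * y < y by rewrite mulrBl mul1r ltrBlDr ltrDl mulr_gt0.
have := right_derive_ge lt.
have -> : y - (1 - s) * y = s * y by ring.
rewrite ler_pdivrMr ?mulr_gt0// => H.
have := right_derive_le_p y0; rewrite -(ler_pM2l s0) => H2.
move: H H2; rewrite [_ * (s * y)]mulrC -[s * y * _]mulrA; lra.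
Qed.

(** The bound [alpha (t x) <= t^p alpha x] with [t = expR s] and [x = expR (- s) * y], obtained by
    showing that [expR (p * t) * alpha (expR (- t) * y)] is nondecreasing in [t]. *)
Lemma young_expR_ge y s : 0 <= y -> 0 <= s ->
  alpha y <= expR (p * s) * alpha (expR (- s) * y).
Proof.
move=> y0 s0.
pose F t := expR (p * t) * alpha (expR (- t) * y).
have -> : alpha y = F 0 by rewrite /F mulr0 oppr0 expR0 !mul1r.
apply: (@le_of_quadratic_drop _ F 0 s (p ^+ 2 * (expR (p * s) * alpha y)) 1) => //.
move=> t u t0 tu us _; rewrite -/(F s).
have p0 : 0 < p by apply: lt_trans p1.
pose d := u - t; have d0 : 0 <= d by rewrite subr_ge0.
have uE : u = t + d by rewrite /d; ring.
have Fle : F t <= expR (p * s) * alpha y.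
  rewrite /F; apply: ler_pM; rewrite ?expR_ge0 ?(young_ge0 Ya)//.
    by rewrite ler_expR ler_pM2l// (le_trans tu).
  apply: young_homo; first by rewrite mulr_ge0 ?expR_ge0.
  by rewrite ler_piMl// expR_le1 oppr_le0.
have F0 : 0 <= F t by rewrite mulr_ge0 ?expR_ge0 ?(young_ge0 Ya).
(* The factor is [(1 + p d) (1 - p d)]: the first comes from the exponential, the second from
   [young_contract_ge]. For [p d >= 1] it is nonpositive and there is nothing to prove. *)
have : (1 - p ^+ 2 * d ^+ 2) * F t <= F u.
  have [pd|pd] := leP 1 (p * d).
    apply: (@le_trans _ _ 0); last by rewrite mulr_ge0 ?expR_ge0 ?(young_ge0 Ya).
    rewrite mulr_le0_ge0// subr_le0 -exprMn exprn_ege1//.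
  rewrite {2}/F uE mulrDr expRD opprD expRD.
  have := @young_contract_ge (expR (- t) * y) (1 - expR (- d)).
  rewrite subKr mulr_ge0 ?expR_ge0// subr_ge0 expR_le1 oppr_le0 d0.
  rewrite lerBlDr lerDl expR_ge0 => /(_ isT isT isT) H.
  have e1 : 1 - expR (- d) <= d by have := expR_ge1Dx (- d); lra.
  have A0 := young_ge0 Ya (expR (- t) * y).
  have {}H : (1 - p * d) * alpha (expR (- t) * y) <= alpha (expR (- d) * (expR (- t) * y)).
    apply: le_trans H; rewrite ler_wpM2r// lerB// ler_wpM2l// ltW//.
  rewrite [expR (- t) * _ * _](_ : _ = expR (- d) * (expR (- t) * y)); last by ring.
  apply: (@le_trans _ _ (expR (p * t) * (1 + p * d) * ((1 - p * d) * alpha (expR (- t) * y)))).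
    by rewrite /F le_eqVlt; apply/orP; left; apply/eqP; ring.
  apply: ler_pM => //.
  - by rewrite mulr_ge0 ?expR_ge0// addr_ge0// mulr_ge0// ltW.
  - by rewrite mulr_ge0// subr_ge0 ltW.
  - by rewrite ler_wpM2l ?expR_ge0// expR_ge1Dx.
have : p ^+ 2 * d ^+ 2 * F t <= p ^+ 2 * d ^+ 2 * (expR (p * s) * alpha y).
  by rewrite ler_wpM2l// mulr_ge0// exprn_ge0// ltW.
rewrite -/d; lra.
Qed.

Lemma young_div_le y e : 0 <= y -> 0 < e -> e <= 1 ->
  e * alpha (y / e) <= expR (- (p - 1) * ln e) * alpha y.
Proof.
move=> y0 e0 e1.
have s0 : 0 <= - ln e by rewrite oppr_ge0 ln_le0.
have := @young_expR_ge (y / e) (- ln e) (divr_ge0 y0 (ltW e0)) s0.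
rewrite opprK lnK ?posrE// [e * (y / e)]mulrC divfK ?gt_eqF// => H.
rewrite (_ : - (p - 1) * ln e = ln e + p * - ln e); last by ring.
by rewrite expRD lnK ?posrE// -mulrA ler_pM2l.
Qed.

(** Convexity at [u + v = (1 - e) (u / (1 - e)) + e (v / e)], then the growth bound on each term.
    Real powers are written as exponentials of logarithms. *)
Lemma young_addr_le u v (e : R) : 0 <= u -> 0 <= v -> 0 < e -> e < 1 ->
  alpha (u + v) <= expR (- (p - 1) * ln (1 - e)) * alpha u
                   + expR (- (p - 1) * ln e) * alpha v.
Proof.
move=> u0 v0 e0 e1; have e'0 : 0 < 1 - e by rewrite subr_gt0.
have -> : u + v = (1 - e) * (u / (1 - e)) + (1 - (1 - e)) * (v / e).
  by rewrite subKr [(1 - e) * _]mulrC [e * _]mulrC !divfK ?gt_eqF.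
have l1 : 1 - e <= 1 by rewrite gerBl ltW.
apply: le_trans (young_conv _ _ (ltW e'0) l1) _.
by rewrite subKr; apply: lerD; apply: young_div_le => //; exact: ltW.
Qed.

(* Convexity of [e |-> (1 - e)^-(p - 1)], obtained by composing the concavity of [ln] with
   the convexity of [expR]. *)
Lemma powN_chord_le (q e e1 : R) : 0 <= q -> 0 < e -> e <= e1 -> e1 < 1 ->
  expR (- q * ln (1 - e)) <= 1 + (expR (- q * ln (1 - e1)) - 1) / e1 * e.
Proof.
move=> q0 e0 ee1 e11; have e10 : 0 < e1 := lt_le_trans e0 ee1.
have t0 : 0 <= e / e1 by rewrite divr_ge0// ltW.
have t1 : e / e1 <= 1 by rewrite ler_pdivrMr// mul1r.
pose s : {i01 R} := Itv01 t0 t1.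
have := @concave_ln R s (1 - e1) 1; rewrite subr_gt0 e11 ltr01 => /(_ isT isT).
rewrite !convRE /= /unstable.onem ln1 mulr0 addr0 mulr1.
have -> : e / e1 * (1 - e1) + (1 - e / e1) = 1 - e.
  by field; rewrite gt_eqF.
move=> H1.
have := @convex_expR R s (- q * ln (1 - e1)) 0.
rewrite !convRE /= /unstable.onem expR0 mulr0 addr0 mulr1 => H2.
apply: (@le_trans _ _ (expR (e / e1 * (- q * ln (1 - e1))))).
  rewrite ler_expR mulrCA; apply: ler_wnM2l => //; first by rewrite oppr_le0.
apply: le_trans H2 _; rewrite le_eqVlt; apply/orP; left; apply/eqP.
by field; rewrite gt_eqF.
Qed.

(** The chord bound makes the weight of [alpha u] linear in [e], with the slope later called [b].
    The singular weight [e^-(p - 1)] falls on [alpha v], the part that becomes the cost term of the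
    logarithmic Sobolev inequality. *)
Lemma young_increment_le u v e e1 : 0 <= u -> 0 <= v -> 0 < e -> e <= e1 -> e1 < 1 ->
  alpha (u + v) - alpha u <=
    (expR (- (p - 1) * ln (1 - e1)) - 1) / e1 * e * alpha u
    + expR (- (p - 1) * ln e) * alpha v.
Proof.
move=> u0 v0 e0 ee1 e11.
have := young_addr_le u0 v0 e0 (le_lt_trans ee1 e11).
have q0 : 0 <= p - 1 by rewrite subr_ge0 ltW.
have := ler_wpM2r (young_ge0 Ya u) (powN_chord_le q0 e0 ee1 e11); lra.
Qed.

(** The slope over [[y, x]] is at most the slope over [[x, x + 1]], itself at most
    [alpha (r + 1)]. *)
Lemma young_lipschitz (r x y : R) : 0 <= y -> y <= x -> x <= r ->
  alpha x - alpha y <= alpha (r + 1) * (x - y).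
Proof.
move=> y0 yx xr.
have := @young_three_points y x (x + 1) yx; rewrite lerDl ler01 => /(_ isT).
have H1 : alpha (x + 1) <= alpha (r + 1).
  by apply: young_homo; rewrite ?lerD2r// addr_ge0// (le_trans y0).
have H2 : (x - y) * alpha (x + 1) <= (x - y) * alpha (r + 1).
  by rewrite ler_wpM2l// subr_ge0.
have H3 : 0 <= (x - y) * alpha x by rewrite mulr_ge0 ?subr_ge0// (young_ge0 Ya).
lra.
Qed.

Lemma young_quasi_triangle : exists2 K, 1 <= K & forall u v, 0 <= u -> 0 <= v ->
  alpha (u + v) <= K * (alpha u + alpha v).
Proof.
have [K K0 KD] := D2; exists (K + 1); first by rewrite lerDr ltW.
move=> u v u0 v0; wlog uv : u v u0 v0 / u <= v => [hw|].
  by have [/hw|/ltW/hw] := leP u v; [exact|rewrite addrC [alpha u + _]addrC; exact].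
apply: (@le_trans _ _ (alpha (2 * v))).
  by apply: young_homo; rewrite ?addr_ge0// mulr_natl mulr2n lerD2r.
apply: le_trans (KD _) _.
have := young_ge0 Ya u; have := young_ge0 Ya v.
have := mulr_ge0 (ltW K0) (young_ge0 Ya u); lra.
Qed.

End young.

(** * Finite linear programming duality *)

(* Bartl's induction: if [b <= 0] fails on the cone cut out by the last functionals, a witness
   [z] of the failure reduces the problem to the kernel of the first functional, which is
   positive at [z]. *)
Lemma farkas (R : realFieldType) (K : Type) (T : eqType) (s : seq T)
    (a : T -> (K -> R) -> R) (b : (K -> R) -> R) : uniq s ->
  (forall t c x y, a t (fun k => c * x k + y k) = c * a t x + a t y) ->
  (forall c x y, b (fun k => c * x k + y k) = c * b x + b y) ->
  (forall x, (forall t, t \in s -> a t x <= 0) -> b x <= 0) ->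
  exists2 l : T -> R, (forall t, t \in s -> 0 <= l t) &
    forall x, b x = \sum_(t <- s) l t * a t x.
Proof.
elim: s a b => [|t0 s IH] a b /=.
  move=> _ _ blin b0; exists (fun=> 0) => // x; rewrite big_nil.
  have b0' y : b y <= 0 by apply: b0.
  have := b0' (fun k => (-2) * x k + x k).
  have := b0' x; rewrite blin; lra.
move=> /andP[t0s us] alin blin Hb.
have cons_l l c x : \sum_(t <- t0 :: s) (if t == t0 then c else l t) * a t x
                    = c * a t0 x + \sum_(t <- s) l t * a t x.
  rewrite big_cons eqxx; congr (_ + _); apply: eq_big_seq => t ts.
  by case: eqP => // tt0; rewrite tt0 (negbTE t0s) in ts.
have cons_ge0 l c : 0 <= c -> (forall t, t \in s -> 0 <= l t) ->
    forall t, t \in t0 :: s -> 0 <= if t == t0 then c else l t.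
  by move=> c0 l0 t; rewrite in_cons; case: eqP => //= _; apply: l0.
have [[z [az bz]]|Hno] := pselect (exists z,
    (forall t, t \in s -> a t z <= 0) /\ 0 < b z); last first.
  have [x xs|l l0 lE] := IH a b us alin blin.
    by rewrite leNgt; apply/negP => bx; apply: Hno; exists x.
  exists (fun t => if t == t0 then 0 else l t); first exact: cons_ge0.
  by move=> x; rewrite cons_l mul0r add0r.
have a0z : 0 < a t0 z.
  rewrite ltNge; apply/negP => a0z.
  suff : b z <= 0 by rewrite leNgt bz.
  by apply: Hb => t; rewrite in_cons => /orP[/eqP->|/az].
(* The functionals composed with the projection along [z] onto the kernel of [a t0]. *)
pose a' t x := a t x - a t z / a t0 z * a t0 x.
pose b' x := b x - b z / a t0 z * a t0 x.
have [t c x y|c x y|x xs|l l0 lE] := IH a' b' us.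
- by rewrite /a' !alin; ring.
- by rewrite /b' !alin !blin; ring.
- have := Hb (fun k => (- (a t0 x / a t0 z)) * z k + x k).
  rewrite blin => H; apply: le_trans (H _).
    by rewrite /b' le_eqVlt; apply/orP; left; apply/eqP; field; rewrite gt_eqF.
  move=> t; rewrite in_cons alin => /orP[/eqP->|ts].
    by rewrite mulNr divfK ?gt_eqF// addNr.
  apply: le_trans (xs _ ts); rewrite /a' le_eqVlt; apply/orP; left; apply/eqP.
  by field; rewrite gt_eqF.
(* Evaluating the identity at [z] forces the coefficient of [t0]; it is nonnegative because
   [b z > 0] and each [a t z <= 0]. *)
exists (fun t => if t == t0 then (b z - \sum_(t <- s) l t * a t z) / a t0 z else l t).
  apply: cons_ge0 => //; apply: divr_ge0; last exact: ltW.
  rewrite subr_ge0 (le_trans _ (ltW bz))//.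
  by rewrite big_seq sumr_le0// => t ts; rewrite mulr_ge0_le0 ?l0 ?az.
move=> x; rewrite cons_l; have := lE x; rewrite /b' /a'.
under eq_bigr do rewrite mulrBr.
rewrite sumrB => /eqP; rewrite subr_eq => /eqP ->.
rewrite mulrBl mulrBl.
suff -> : \sum_(i <- s) l i * (a i z / a t0 z * a t0 x) =
   (\sum_(t <- s) l t * a t z) / a t0 z * a t0 x by ring.
by rewrite !mulr_suml; apply: eq_bigr => i _; rewrite !mulrA.
Qed.

(* The unknowns [(f, g, t)] are encoded as [x (Some (inl i))], [x (Some (inr j))] and [x None],
   the homogenising variable [t] multiplying [c] and [V]. *)
Lemma finite_kantorovich (R : realFieldType) (I J : finType) (i0 : I) (j0 : J)
    (u : I -> R) (v : J -> R) (c : I -> J -> R) (V : R) :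
  (forall i, 0 <= u i) -> (forall j, 0 <= v j) ->
  \sum_i u i = 1 -> \sum_j v j = 1 ->
  (forall f g, (forall i j, f i - g j <= c i j) ->
     \sum_i f i * u i - \sum_j g j * v j <= V) ->
  exists pi : I -> J -> R,
    [/\ forall i j, 0 <= pi i j, forall i, \sum_j pi i j = u i,
        forall j, \sum_i pi i j = v j & \sum_i \sum_j pi i j * c i j <= V].
Proof.
move=> u0 v0 u1 v1 HV.
pose a (t : option (I * J)) (x : option (I + J) -> R) : R :=
  if t is Some (i, j) then
    x (Some (inl i)) - x (Some (inr j)) - c i j * x None
  else - x None.
pose b (x : option (I + J) -> R) : R := \sum_i x (Some (inl i)) * u i
  - \sum_j x (Some (inr j)) * v j - V * x None.
have [||k x y|x xa|l l0 lE] := @farkas R _ _ (index_enum (option (I * J))) a b.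
- exact: index_enum_uniq.
- by case=> [[i j]|] k x y /=; ring.
- rewrite /b; under eq_bigr do rewrite mulrDl.
  under [X in _ - X - _ = _]eq_bigr do rewrite mulrDl.
  rewrite !big_split /= !mulrDr !mulrN !mulr_sumr.
  under [X in X + _ - _ - _ = _]eq_bigr do rewrite -mulrA.
  under [X in _ - (X + _) - _ = _]eq_bigr do rewrite -mulrA.
  ring.
- have {}xa t : a t x <= 0 by apply: xa; rewrite mem_index_enum.
  have := xa None; rewrite /= oppr_le0 le_eqVlt => /orP[/eqP t0|t0].
    (* With the homogenising variable at 0, every value of [f] is at most every value of [g]; as [u]
       and [v] both have mass 1, the minimum of [g] separates the two sums. *)
    have {}xa i j : x (Some (inl i)) <= x (Some (inr j)).
      by have := xa (Some (i, j)); rewrite /= -t0 mulr0 subr0 subr_le0.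
    have [/= j1 _ j1P] := @Order.TotalTheory.arg_minP _ _ _ j0 predT (fun j => x (Some (inr j))) isT.
    rewrite /b -t0 mulr0 subr0 subr_le0.
    apply: (@le_trans _ _ (x (Some (inr j1)))).
      rewrite -[leRHS]mulr1 -u1 mulr_sumr; apply: ler_sum => i _.
      by rewrite ler_wpM2r.
    rewrite -[leLHS]mulr1 -v1 mulr_sumr; apply: ler_sum => j _.
    by rewrite ler_wpM2r// j1P.
  have := HV (fun i => x (Some (inl i)) / x None) (fun j => x (Some (inr j)) / x None).
  have H i j : x (Some (inl i)) / x None - x (Some (inr j)) / x None <= c i j.
    rewrite -mulrBl ler_pdivrMr//.
    by have := xa (Some (i, j)); rewrite /=; lra.
  move=> /(_ H).
  under eq_bigr do rewrite mulrAC.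
  under [X in _ - X <= _]eq_bigr do rewrite mulrAC.
  by rewrite -!mulr_suml -mulrBl ler_pdivrMr// /b subr_le0.
have {}l0 t : 0 <= l t by apply: l0; rewrite mem_index_enum.
have sumE (F : option (I * J) -> R) : \sum_t F t = F None + \sum_i \sum_j F (Some (i, j)).
  rewrite (bigD1 None)//=; congr (_ + _).
  rewrite pair_big /= (reindex_omap Some id); last by case.
  by apply: eq_big => [[i j]|[i j]] //=; rewrite eqxx.
pose simp := (@mulrN1 R, @mulr0 R, @subr0 R, @oppr0 R, @addr0 R, @add0r R, @mulr1 R, @opprK R).
(* The multipliers of the constraints form the plan. The identity at coordinate vectors reads off
   the marginals; at the homogenising coordinate it gives the cost bound, with [l None >= 0] as
   slack. *)
exists (fun i j => l (Some (i, j))); split => //.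
- move=> i; have := lE (fun k => if k == Some (inl i) then 1 else 0).
  rewrite sumE /b /= (bigD1 i)//= eqxx mul1r big1 => [|k /negPf ki]; last first.
    by rewrite (_ : _ == _ = false) ?mul0r//.
  rewrite big1 => [|k _]; last by rewrite mul0r.
  rewrite !simp => ->; rewrite (bigD1 i)//=.
  rewrite [X in _ + X]big1 => [|k /negPf ki].
    by rewrite !simp; apply: eq_bigr => j _; rewrite eqxx !simp.
  apply: big1 => j _; rewrite (_ : _ == _ = false) ?simp//.
- move=> j; have := lE (fun k => if k == Some (inr j) then -1 else 0).
  rewrite sumE /b /= big1 => [|k _]; last by rewrite mul0r.
  rewrite (bigD1 j)//= eqxx mulN1r big1 => [|k /negPf kj]; last first.
    by rewrite (_ : _ == _ = false) ?mul0r//.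
  rewrite !simp => ->; apply: eq_bigr => i _.
  rewrite (bigD1 j)//= big1 => [|k /negPf kj]; first by rewrite eqxx !simp.
  rewrite (_ : _ == _ = false) ?simp//.
- have := lE (fun k => if k == None then -1 else 0); rewrite sumE /b /=.
  rewrite big1 => [|k _]; last by rewrite mul0r.
  rewrite big1 => [|k _]; last by rewrite mul0r.
  rewrite !simp => ->; rewrite -[leLHS]add0r lerD//.
  rewrite le_eqVlt; apply/orP; left; apply/eqP.
  by apply: eq_bigr => i _; apply: eq_bigr => j _; rewrite !simp.
Qed.

(** * Densities and entropy *)

Section bounded_measurable.
Context d (T : measurableType d) (R : realType).
Implicit Types (f g : T -> R) (P : probability T R).

(** A bound that holds everywhere serves all probabilities at once: on this class, stable under
    products and [expR], the real-valued integral is linear and monotone. *)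
Definition bounded_measurable f :=
  measurable_fun setT f /\ exists M, forall x, `|f x| <= M.

Lemma bm_cst (c : R) : bounded_measurable (fun=> c).
Proof. by split; [exact: measurable_cst|exists `|c|]. Qed.

Lemma bmD f g : bounded_measurable f -> bounded_measurable g ->
  bounded_measurable (fun x => f x + g x).
Proof.
move=> [mf [M fM]] [mg [N gN]]; split; first exact: measurable_funD.
by exists (M + N) => x; rewrite (le_trans (ler_normD _ _))// lerD.
Qed.

Lemma bmM f g : bounded_measurable f -> bounded_measurable g ->
  bounded_measurable (fun x => f x * g x).
Proof.
move=> [mf [M fM]] [mg [N gN]]; split; first exact: measurable_funM.
by exists (M * N) => x; rewrite normrM ler_pM.
Qed.

Lemma bmZ c f : bounded_measurable f -> bounded_measurable (fun x => c * f x).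
Proof. by move=> bf; apply: bmM => //; exact: bm_cst. Qed.

Lemma bmB f g : bounded_measurable f -> bounded_measurable g ->
  bounded_measurable (fun x => f x - g x).
Proof.
move=> bf /(bmZ (-1)) bg; have := bmD bf bg.
by congr bounded_measurable; apply/funext => x; rewrite mulN1r.
Qed.

Lemma bm_expR f : bounded_measurable f -> bounded_measurable (fun x => expR (f x)).
Proof.
move=> [mf [M fM]]; split; first exact: measurableT_comp.
exists (expR M) => x; rewrite ger0_norm ?expR_ge0// ler_expR.
exact: le_trans (ler_norm _) _.
Qed.

Lemma bm_integrable P f : bounded_measurable f -> P.-integrable setT (EFin \o f).
Proof.
move=> [mf [M fM]]; apply: measurable_bounded_integrable => //.
  by rewrite [X in (X < _)%E](_ : _ = 1%E) ?ltry//; exact: probability_setT.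
exists M; split; first exact: num_real.
by move=> N MN x _; exact: le_trans (fM x) (ltW MN).
Qed.

Lemma intD P f g : bounded_measurable f -> bounded_measurable g ->
  \int[P]_x (f x + g x) = \int[P]_x f x + \int[P]_x g x.
Proof. by move=> bf bg; apply: RintegralD => //; exact: bm_integrable. Qed.

Lemma intB P f g : bounded_measurable f -> bounded_measurable g ->
  \int[P]_x (f x - g x) = \int[P]_x f x - \int[P]_x g x.
Proof. by move=> bf bg; apply: RintegralB => //; exact: bm_integrable. Qed.

Lemma intZ P c f : bounded_measurable f ->
  \int[P]_x (c * f x) = c * \int[P]_x f x.
Proof. by move=> bf; apply: RintegralZl => //; exact: bm_integrable. Qed.

Lemma int_cst P c : \int[P]_x (fun=> c) x = c.
Proof.
rewrite Rintegral_cst// [X in fine X](_ : _ = 1%E) ?mulr1//.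
exact: probability_setT.
Qed.

Lemma int_le P f g : bounded_measurable f -> bounded_measurable g ->
  (forall x, f x <= g x) -> \int[P]_x f x <= \int[P]_x g x.
Proof. by move=> bf bg fg; apply: le_Rintegral => //; exact: bm_integrable. Qed.

Lemma int_EFin P f : bounded_measurable f ->
  (\int[P]_x (f x)%:E)%E = (\int[P]_x f x)%:E.
Proof.
move=> bf; rewrite /Rintegral fineK//; apply: integrable_fin_num => //.
exact: bm_integrable.
Qed.

Lemma int_expR_gt0 P f : bounded_measurable f -> 0 < \int[P]_x expR (f x).
Proof.
move=> bf; have [_ [M fM]] := bf.
apply: (@lt_le_trans _ _ (expR (- M))); first exact: expR_gt0.
rewrite -[leLHS](int_cst P); apply: int_le; [exact: bm_cst|exact: bm_expR|].
by move=> x; rewrite ler_expR; have := fM x; rewrite ler_norml => /andP[].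
Qed.

(* Jensen's inequality for the tilted probability of density [expR w' / \int expR w']. *)
Lemma gibbs_ln P w w' : bounded_measurable w -> bounded_measurable w' ->
  \int[P]_x ((w x - w' x) * expR (w' x)) <=
  (ln (\int[P]_x expR (w x)) - ln (\int[P]_x expR (w' x))) * \int[P]_x expR (w' x).
Proof.
move=> bw bw'; set Z := \int[P]_x expR (w x); set Z' := \int[P]_x expR (w' x).
have Z0 : 0 < Z := int_expR_gt0 P bw.
have Z'0 : 0 < Z' := int_expR_gt0 P bw'.
have bd := bmB bw bw'; have be := bm_expR bw'.
set m := ln Z - ln Z'.
have Em : expR m = Z / Z' by rewrite expRB !lnK.
suff : expR m * (\int[P]_x ((w x - w' x) * expR (w' x)) + (1 - m) * Z') <= Z.
  rewrite Em -ler_pdivlMl ?divr_gt0// invf_div divfK ?gt_eqF//; lra.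
rewrite -intZ// -intD//; [|exact: bmM|exact: bmZ].
rewrite -intZ; last by apply: bmD; [exact: bmM|exact: bmZ].
apply: int_le; [by apply: bmZ; apply: bmD; [exact: bmM|exact: bmZ]|exact: bm_expR|].
move=> x; rewrite -mulrDl mulrA.
have -> : expR (w x) = expR m * expR (w x - w' x - m) * expR (w' x).
  by rewrite -!expRD; congr expR; ring.
apply: ler_wpM2r; first exact: expR_ge0.
apply: ler_wpM2l; first exact: expR_ge0.
have := expR_ge1Dx (w x - w' x - m); lra.
Qed.

Lemma jensen_ln P w : bounded_measurable w ->
  \int[P]_x w x <= ln (\int[P]_x expR (w x)).
Proof.
move=> bw; have := gibbs_ln P bw (bm_cst 0).
rewrite expR0 int_cst mulr1 ln1 subr0; apply: le_trans.
by rewrite le_eqVlt; apply/orP; left; apply/eqP; apply: eq_Rintegral => x _; ring.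
Qed.

End bounded_measurable.

(** * Densities and change of measure *)

Section density.
Context d (T : measurableType d) (R : realType).
Implicit Types (P Q : probability T R) (r : T -> R).
Local Open Scope ereal_scope.

Definition is_density Q P r := forall A, measurable A -> Q A = \int[P]_(x in A) (r x)%:E.

Section construction.
Variables (P : probability T R) (r : T -> R).
Hypotheses (mr : measurable_fun setT r) (r0 : forall x, (0 <= r x)%R).

Definition density_measure of measurable_fun setT r & (forall x, (0 <= r x)%R) :=
  fun A => \int[P]_(x in A) (r x)%:E.

Local Notation nu := (density_measure mr r0).

Let nu0 : nu set0 = 0. Proof. exact: integral_set0. Qed.

Let nu_ge0 A : 0 <= nu A.
Proof. by apply: integral_ge0 => x _; rewrite lee_fin. Qed.

Let nu_sigma_additive : semi_sigma_additive nu.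
Proof.
apply: semi_sigma_additive_nng_induced => [|x]; last by rewrite lee_fin.
exact/measurable_EFinP.
Qed.

HB.instance Definition _ := isMeasure.Build _ _ _ nu nu0 nu_ge0 nu_sigma_additive.

Lemma density_exists : \int[P]_x (r x)%:E = 1 -> exists Q, is_density Q P r.
Proof.
move=> r1; exists (mnormalize nu P) => A mA.
rewrite /= /mnormalize /= /density_measure r1 onee_eq0 /=.
by rewrite invr1 mule1.
Qed.

End construction.

Variables (P Q : probability T R) (r : T -> R).
Hypotheses (mr : measurable_fun setT r) (r0 : forall x, (0 <= r x)%R).
Hypothesis rQ : is_density Q P r.

Lemma density_dominates : Q `<< P.
Proof.
apply/null_content_dominatesP => A mA PA0; rewrite rQ//.
by apply: null_set_integral => //; exact/measurable_funTS/measurable_EFinP.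
Qed.

Lemma density_ae : ae_eq P setT (Radon_Nikodym_SigmaFinite.f Q P) (EFin \o r).
Proof.
apply: integral_ae_eq => //.
- exact/Radon_Nikodym_SigmaFinite.f_integrable/density_dominates.
- exact/measurable_EFinP.
- move=> A _ mA; rewrite -Radon_Nikodym_SigmaFinite.f_integral//; first exact: rQ.
  exact: density_dominates.
Qed.

Lemma ge0_integral_density (f : T -> \bar R) : measurable_fun setT f ->
  (forall x, 0 <= f x) -> \int[Q]_x f x = \int[P]_x (f x * (r x)%:E).
Proof.
move=> mf f0; have QP := density_dominates.
rewrite -(Radon_Nikodym_SigmaFinite.change_of_variables QP)//.
apply: ae_eq_integral => //.
- apply: emeasurable_funM => //.
  exact: measurable_int (Radon_Nikodym_SigmaFinite.f_integrable QP).
- by apply: emeasurable_funM => //; exact/measurable_EFinP.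
- by apply: ae_eqe_mul2l; exact: density_ae.
Qed.

Lemma Radon_Nikodym_density :
  ae_eq Q setT (Radon_Nikodym (charge_of_finite_measure Q) P) (EFin \o r).
Proof.
apply: (null_dominates_ae_eq _ density_dominates) => //.
apply: ae_eq_trans density_ae.
by apply: ae_eq_sym; apply: ae_eq_Radon_Nikodym_SigmaFinite => //; exact: density_dominates.
Qed.

(** The zeros of [r] form a null set for [Q], so the value of a logarithm there is immaterial. *)
Lemma density_pos_ae (f g : T -> \bar R) : (forall x, (0 < r x)%R -> f x = g x) ->
  ae_eq Q setT f g.
Proof.
move=> fg; exists [set x | r x = 0%R]; split.
- rewrite -[X in measurable X]setTI; apply: (mr _ (measurable_set1 0%R)) => //.
- apply: etrans (rQ _) _.
    by rewrite -[X in measurable X]setTI; exact: (mr _ (measurable_set1 0%R)).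
  by apply: integral0_eq => x /= ->.
- move=> x /= H; apply/eqP; rewrite eq_le r0 andbT leNgt; apply/negP => rx.
  by apply: H => _; exact: fg.
Qed.

Lemma measurable_lne_EFin : measurable_fun setT (fun x => lne (r x)%:E).
Proof.
apply: measurable_fun_ifT => //.
- exact: measurable_fun_ler.
- by apply/measurable_EFinP; exact: measurableT_comp.
Qed.

Lemma integral_lne_density :
  \int[Q]_x lne (Radon_Nikodym (charge_of_finite_measure Q) P x) =
  \int[Q]_x lne (r x)%:E.
Proof.
have QP := density_dominates.
apply: ae_eq_integral => //; last 2 first.
- exact: measurable_lne_EFin.
- by apply: filterS Radon_Nikodym_density => x /= H /H ->.
pose s x := fine (Radon_Nikodym (charge_of_finite_measure Q) P x).
rewrite (_ : (fun x => _) = fun x => lne (s x)%:E); last first.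
  by apply/funext => x; rewrite /s fineK// Radon_Nikodym_fin_num.
apply: measurable_fun_ifT => //.
- apply: measurable_fun_ler => //; apply: measurableT_comp => //.
- apply/measurable_EFinP; apply: measurableT_comp => //.
  by apply: measurableT_comp => //.
Qed.

End density.

Section density_theory.
Context d (T : measurableType d) (R : realType).
Implicit Types (P Q : probability T R) (r f : T -> R).

Lemma dominated_density Q P : Q `<< P ->
  exists r, [/\ measurable_fun setT r, forall x, 0 <= r x & is_density Q P r].
Proof.
move=> QP; exists (fun x => fine (Radon_Nikodym_SigmaFinite.f Q P x)); split.
- apply: measurableT_comp => //.
  exact: measurable_int (Radon_Nikodym_SigmaFinite.f_integrable QP).
- by move=> x; rewrite fine_ge0// Radon_Nikodym_SigmaFinite.f_ge0.
- move=> A mA.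
  apply: etrans (Radon_Nikodym_SigmaFinite.f_integral QP mA) _.
  by apply: eq_integral => x _; rewrite fineK// Radon_Nikodym_SigmaFinite.f_fin_num.
Qed.

Lemma density_int1 Q P r : is_density Q P r -> \int[P]_x r x = 1.
Proof.
move=> rQ; rewrite /Rintegral -rQ// [X in fine X](_ : _ = 1%E)//.
exact: probability_setT.
Qed.

Lemma int_density Q P r f : bounded_measurable r -> (forall x, 0 <= r x) ->
  is_density Q P r -> bounded_measurable f ->
  \int[Q]_x f x = \int[P]_x (f x * r x).
Proof.
move=> br r0 rQ bf; have [mf [M fM]] := bf.
have bM := @bm_cst _ T _ M; have bfM := bmD bf bM.
(* Adding [M] makes the integrand nonnegative, as the change of density requires; the shift cancels
   because [r] has integral 1. *)
have : (\int[Q]_x (f x + M)%:E = \int[P]_x ((f x + M) * r x)%:E)%E.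
  rewrite (ge0_integral_density br.1 rQ)//; first exact/measurable_EFinP/bfM.1.
  by move=> x; rewrite lee_fin -lerBlDr sub0r; have := fM x; rewrite ler_norml => /andP[].
rewrite int_EFin// int_EFin; last exact: bmM.
move=> [] ; rewrite intD// int_cst.
under [X in _ = X -> _]eq_Rintegral do rewrite mulrDl.
rewrite intD; [|exact: bmM|exact: bmZ].
by rewrite intZ// (density_int1 rQ) mulr1 => /addIr.
Qed.

Lemma exp_density_exists P (w : T -> R) : bounded_measurable w ->
  exists Q : probability T R,
    is_density Q P (fun x => expR (w x) / \int[P]_x expR (w x)).
Proof.
move=> bw; have Z0 := int_expR_gt0 P bw; have be := bm_expR bw.
have br : bounded_measurable (fun x => expR (w x) / \int[P]_x expR (w x)).
  by apply: bmM => //; exact: bm_cst.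
apply: density_exists br.1 _ _ => [x|]; first by rewrite divr_ge0 ?expR_ge0// ltW.
rewrite int_EFin//; under eq_Rintegral do rewrite mulrC.
by rewrite intZ// mulVf// gt_eqF.
Qed.

Lemma integral_lne_exp_density Q P w : bounded_measurable w ->
  (\int[Q]_x lne (expR (w x) / \int[P]_x expR (w x))%:E =
   (\int[Q]_x w x - ln (\int[P]_x expR (w x)))%:E)%E.
Proof.
move=> bw; have Z0 := int_expR_gt0 P bw.
rewrite -[X in (_ - X)%R](int_cst Q (ln _)) -intB//; last exact: bm_cst.
rewrite -int_EFin; last by apply: bmB => //; exact: bm_cst.
apply: eq_integral => x _; rewrite lne_EFin ?divr_gt0 ?expR_gt0//.
by rewrite ln_div ?posrE ?expR_gt0// expRK.
Qed.

(* The pointwise bound is [ln r >= F - c + 1 - exp (F - c) / r], an instance of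
   [ln t >= 1 - 1 / t]. *)
Lemma gibbs_le_entropy Q P r (F : T -> R) :
  measurable_fun setT r -> (forall x, 0 <= r x) -> is_density Q P r ->
  bounded_measurable F ->
  ((\int[Q]_x F x - ln (\int[P]_x expR (F x)))%:E <= \int[Q]_x lne (r x)%:E)%E.
Proof.
move=> mr r0 rQ bF; set Z := \int[P]_x expR (F x).
have Z0 : 0 < Z := int_expR_gt0 P bF; set c := ln Z.
have bc := @bm_cst _ T _ c; have bFc := bmB bF bc; have beFc := bm_expR bFc.
pose g1 x := F x - c + 1; pose g2 x := expR (F x - c) / r x.
have bg1 : bounded_measurable g1 by apply: bmD => //; exact: bm_cst.
have mg2 : measurable_fun setT g2.
  apply: measurable_funM; first exact: beFc.1.
  rewrite (_ : (fun x => _) = (@powR R ^~ (-1)) \o r).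
    by apply: measurableT_comp => //; exact: measurable_powR.
  by apply/funext => x; rewrite /= powR_inv1.
have g20 x : 0 <= g2 x by rewrite divr_ge0 ?expR_ge0.
(* Only an inequality: the part of [expR (F x - c)] carried by the zeros of [r] is lost. *)
have int_g2 : (\int[Q]_x (g2 x)%:E <= 1)%E.
  rewrite (ge0_integral_density mr rQ)//; last exact/measurable_EFinP.
  apply: (@le_trans _ _ (\int[P]_x (expR (F x - c))%:E)%E).
    apply: ge0_le_integral => //.
    - by move=> x _; rewrite mule_ge0 ?lee_fin.
    - by apply: emeasurable_funM; exact/measurable_EFinP.
    - exact/measurable_EFinP/beFc.1.
    - move=> x _; rewrite -EFinM lee_fin /g2.
      have := r0 x; rewrite le_eqVlt => /orP[/eqP <-|rx].
        by rewrite mulr0 expR_ge0.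
      by rewrite divfK// gt_eqF.
  rewrite int_EFin//; under eq_Rintegral do rewrite expRB mulrC.
  by rewrite intZ; [rewrite lnK// mulVf// gt_eqF|exact: bm_expR].
have ig2 : Q.-integrable setT (EFin \o g2).
  apply/integrableP; split; first exact/measurable_EFinP.
  under eq_integral do rewrite /= ger0_norm//.
  exact: le_lt_trans int_g2 (ltry 1).
have ig : Q.-integrable setT (EFin \o (fun x => g1 x - g2 x)).
  rewrite (_ : _ \o _ = (EFin \o g1) \- (EFin \o g2))%E//.
  by apply: integrableB => //; exact: bm_integrable.
(* On the [Q]-null set where [r] vanishes the logarithm is replaced by [g1], so that [f] is
   real-valued and dominates [g1 - g2] everywhere. *)
pose f x := if 0 < r x then ln (r x) else g1 x.
have mf : measurable_fun setT f.
  apply: measurable_fun_ifT; [exact: measurable_fun_ltr|exact: measurableT_comp|exact: bg1.1].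
have gf x : g1 x - g2 x <= f x.
  rewrite /f; case: ifPn => [rx|_]; last by rewrite gerBl.
  have g2x : 0 < g2 x by rewrite divr_gt0// expR_gt0.
  have : ln (g2 x) <= g2 x - 1.
    by rewrite -{1}[g2 x](subrKC 1) le_ln1Dx// ltrBrDl subrr.
  by rewrite ln_div ?posrE ?expR_gt0// expRK /g1; lra.
have -> : (\int[Q]_x lne (r x)%:E = \int[Q]_x (f x)%:E)%E.
  apply: ae_eq_integral => //; first exact: measurable_lne_EFin.
    exact/measurable_EFinP.
  by apply: (density_pos_ae mr r0 rQ) => x rx; rewrite lne_EFin// /f rx.
apply: (@le_trans _ _ (\int[Q]_x (g1 x - g2 x)%:E)%E).
  have -> : (\int[Q]_x (g1 x - g2 x)%:E = \int[Q]_x (g1 x)%:E - \int[Q]_x (g2 x)%:E)%E.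
    by under eq_integral do rewrite EFinB; apply: integralB_EFin => //; exact: bm_integrable.
  rewrite int_EFin// /g1 intD//; last exact: bm_cst.
  rewrite intB// !int_cst (EFinD (_ - _) 1) -addeA leeDl//.
  by rewrite sube_ge0// ?int_g2// orbT.
have mg : measurable_fun setT (fun x => (g1 x - g2 x)%:E) by exact: measurable_int ig.
have mEf : measurable_fun setT (EFin \o f) by exact/measurable_EFinP.
(* As [f] may fail to be integrable, positive and negative parts are compared separately. *)
rewrite integralE [leRHS]integralE; apply: leeB.
- apply: ge0_le_integral => //; [exact: measurable_funepos|exact: measurable_funepos|].
  by move=> x _; apply: (@funepos_le _ _ setT) => [y _|]; rewrite ?lee_fin ?inE.
- apply: ge0_le_integral => //; [exact: measurable_funeneg|exact: measurable_funeneg|].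
  by move=> x _; apply: (@funeneg_le _ _ setT) => [y _|]; rewrite ?lee_fin ?inE.
Qed.

End density_theory.

(** * Borel measurability of the cost *)

Section borel_metric.
Context {R : realType} {X : completeMetricType R}.
Implicit Types (x y : X) (alpha : R -> R).

Lemma borel_open (A : set X) : open A -> measurable (A : set (borel X)).
Proof. exact: sub_sigma_algebra. Qed.

Lemma measurable_gt_fun d (T : measurableType d) (f : T -> R) :
  (forall a, measurable [set t | a < f t]) -> measurable_fun setT f.
Proof.
move=> H; apply: (measurability _ (RGenOInfty.measurableE R)).
move=> _ [_ [a ->] <-]; rewrite setTI preimage_itvoy; exact: H.
Qed.

Lemma measurable_lt_fun d (T : measurableType d) (f : T -> R) :
  (forall a, measurable [set t | f t < a]) -> measurable_fun setT f.
Proof.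
move=> H; rewrite (_ : f = (fun t => - (- f t))); last first.
  by apply/funext => t; rewrite opprK.
apply: measurableT_comp => //; apply: measurable_gt_fun => a.
by under eq_set do rewrite ltrNr; exact: H.
Qed.

Lemma mdist_lipschitz x x' y : mdist x y <= mdist x' y + mdist x x'.
Proof. by rewrite addrC; exact: metric_triangle. Qed.

Lemma open_mdist_cond (P : X -> Prop) :
  (forall x, P x -> exists2 e, 0 < e & forall x', mdist x x' < e -> P x') ->
  open [set x | P x].
Proof.
move=> H; rewrite openE => x /H[e e0 xP]; apply/nbhs_ballP; exists e => //.
by move=> x'; rewrite ballEmdist => /xP.
Qed.

Lemma open_mdist_lt y r : open [set x : X | mdist x y < r].
Proof.
apply: open_mdist_cond => x xr; exists (r - mdist x y); first by rewrite subr_gt0.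
move=> x' xx'; have := mdist_lipschitz x' x y; rewrite [mdist x' x]metric_sym.
by move: xx'; lra.
Qed.

Lemma separable_seq : separable X ->
  exists u : nat -> X, forall x r, 0 < r -> exists n, mdist x (u n) < r.
Proof.
move=> [D /countable_injP[f injf] dD].
exists (fun n => xget point [set x | D x /\ f x = n]) => x r r0.
have [|z [/= zr Dz]] := dD [set z | mdist z x < r] _ (open_mdist_lt x r).
  by exists x; rewrite /= mdistxx.
exists (f z); have [] := @xgetPex _ point [set y | D y /\ f y = f z].
  by exists z.
set z' := xget _ _ => Dz' ff; rewrite metric_sym (_ : z' = z)//.
by apply: injf; rewrite ?inE.
Qed.

(** The open set where the distance is below [r] has to lie in the product sigma-algebra:
    separability makes it a countable union of rectangles, indexed by a dense sequence and the
    rationals. *)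
Lemma measurable_mdist : separable X ->
  measurable_fun setT (fun z : borel X * borel X => mdist (z.1 : X) (z.2 : X)).
Proof.
move=> /separable_seq[u uP]; apply: measurable_lt_fun => r.
rewrite (_ : [set z | _] = \bigcup_n \bigcup_(q : rat)
   ([set x : borel X | mdist (x : X) (u n) < ratr q] `*`
    [set y : borel X | mdist (y : X) (u n) < r - ratr q])); last first.
  apply/seteqP; split => [[x y] /= xy|[x y] [n _ [q _ [/= xq yq]]]]; last first.
    have := metric_triangle (x : X) (u n) y; rewrite [mdist (u n) y]metric_sym.
    by move: xq yq; lra.
  have [n xn] := uP x ((r - mdist (x : X) y) / 3%:R) ltac:(by rewrite divr_gt0// subr_gt0).
  have := metric_triangle (y : X) x (u n); rewrite [mdist (y : X) x]metric_sym => yn.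
  have [q] := @rat_in_itvoo R (mdist (x : X) (u n)) ((r - mdist (x : X) y) / 3%:R) xn.
  rewrite in_itv/= => /andP[q1 q2].
  exists n => //; exists q => //; split => //=.
  by move: yn xn q1 q2 xy; lra.
apply: bigcupT_measurable => n; apply: bigcupT_measurable_rat => q.
by apply: measurableX; apply: borel_open; exact: open_mdist_lt.
Qed.

(** By evenness only absolute values matter, and there [alpha] is Lipschitz on [[0, |x| + 1]] with
    constant [alpha (|x| + 2)]. *)
Lemma young_continuous alpha : young_function alpha -> continuous alpha.
Proof.
move=> Ya x; have [r0 rE] : 0 <= alpha (`|x| + 2) /\ forall y : R, alpha y = alpha `|y|.
  split; first exact: young_ge0 Ya _.
  by move=> y; have [//|y0] := ger0P y; rewrite (young_even Ya).
apply/cvgrPdist_lt => e e0; near=> t.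
have xy1 : `|x - t| < 1.
  near: t; apply/nbhs_ballP; exists 1; first exact: ltr01.
  by move=> t; rewrite /ball /=.
have xye : `|x - t| < e / (alpha (`|x| + 2) + 1).
  near: t; apply/nbhs_ballP; exists (e / (alpha (`|x| + 2) + 1)) => /=.
    by rewrite divr_gt0// ltr_wpDl.
  by move=> t; rewrite /ball /=.
have L (u v : R) : 0 <= u -> u <= `|x| + 1 -> 0 <= v -> v <= `|x| + 1 ->
    `|alpha u - alpha v| <= alpha (`|x| + 2) * `|u - v|.
  wlog uv : u v / v <= u.
    move=> hw; have [/hw|/ltW/hw] := leP v u; first exact.
    by rewrite distrC [`|u - v|]distrC => + *; apply.
  move=> u0 ux v0 vx; rewrite ger0_norm ?subr_ge0; last exact: (young_homo Ya).
  rewrite [`|u - v|]ger0_norm ?subr_ge0//.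
  have := @young_lipschitz _ _ Ya (`|x| + 1) u v v0 uv ux.
  by rewrite -addrA.
rewrite (rE x) (rE t).
have tx : `|t| <= `|x| + 1.
  have := ler_normB x (x - t); rewrite subKr => /le_trans; apply.
  by rewrite lerD2l ltW.
apply: le_lt_trans (L _ _ _ _ _ tx) _ => //; first by rewrite lerDl.
apply: (@le_lt_trans _ _ (alpha (`|x| + 2) * `|x - t|)).
  by rewrite ler_wpM2l// ler_dist_dist.
apply: (@le_lt_trans _ _ ((alpha (`|x| + 2) + 1) * `|x - t|)).
  by rewrite ler_wpM2r// lerDl.
by rewrite -ltr_pdivlMl ?ltr_wpDl// mulrC.
Unshelve. all: by end_near. Qed.

Lemma measurable_cost alpha : separable X -> young_function alpha ->
  measurable_fun setT (fun z : borel X * borel X => alpha (mdist (z.1 : X) (z.2 : X))).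
Proof.
move=> sX Ya; apply: (measurableT_comp (f := alpha)); last exact: measurable_mdist.
by apply: continuous_measurable_fun; exact: young_continuous.
Qed.

Lemma open_cost_lt alpha y c : young_function alpha ->
  open [set x : X | alpha (mdist x y) < c].
Proof.
move=> Ya; apply: open_mdist_cond => x xc.
set d := mdist x y in xc *; pose l := alpha (d + 2) + 1.
have l0 : 0 < l by rewrite ltr_wpDl// (young_ge0 Ya).
exists (Num.min 1 ((c - alpha d) / l)).
  by rewrite lt_min ltr01 divr_gt0// subr_gt0.
move=> x'; rewrite lt_min => /andP[xx1 xxl].
have H := mdist_lipschitz x' x y; rewrite [mdist x' x]metric_sym in H.
apply: le_lt_trans (young_homo Ya (mdist_ge0 _ _) H) _; rewrite -/d.
have d0 : 0 <= d := mdist_ge0 _ _.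
have := @young_lipschitz _ _ Ya (d + 1) (d + mdist x x') d d0.
rewrite lerDl mdist_ge0 lerD2l (ltW xx1) => /(_ isT isT).
rewrite -[d + 1 + 1]addrA [d + _ - d]addrC addKr (_ : (1 + 1 = 2 :> R))// => H2.
move: xxl; rewrite ltr_pdivlMr// /l.
have := mdist_ge0 x x'; move: H2; rewrite [mdist x x' * _]mulrC mulrDl mul1r; lra.
Qed.

End borel_metric.

(** * Transport and logarithmic Sobolev inequalities *)

Section coupling_theory.
Context {R : realType} {X : completeMetricType R}.
Implicit Types (mu nu : probability (borel X) R) (alpha : R -> R).

Lemma int_image d1 d2 (S : measurableType d1) (T : measurableType d2)
    (P : probability S R) (Q : probability T R) (phi : S -> T) (f : T -> R) :
  measurable_fun setT phi -> (forall A, measurable A -> P (phi @^-1` A) = Q A) ->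
  bounded_measurable f -> \int[P]_x f (phi x) = \int[Q]_x f x.
Proof.
move=> mphi PQ bf; congr fine.
have bfp : bounded_measurable (fun x => f (phi x)).
  have [mf [M fM]] := bf; split; first exact: measurableT_comp.
  by exists M => x; exact: fM.
transitivity (\int[pushforward P phi]_y (f y)%:E)%E; last first.
  by apply: eq_measure_integral => A mA _; exact: PQ.
rewrite (integral_pushforward mphi)//; first exact/measurable_EFinP/bf.1.
by rewrite preimage_setT; exact: bm_integrable bfp.
Qed.

Lemma ge0_integral_image d1 d2 (S : measurableType d1) (T : measurableType d2)
    (P : probability S R) (Q : probability T R) (phi : S -> T) (f : T -> \bar R) :
  measurable_fun setT phi -> (forall A, measurable A -> P (phi @^-1` A) = Q A) ->
  measurable_fun setT f -> (forall x, (0 <= f x)%E) ->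
  (\int[P]_x f (phi x) = \int[Q]_x f x)%E.
Proof.
move=> mphi PQ mf f0.
transitivity (\int[pushforward P phi]_y f y)%E; last first.
  by apply: eq_measure_integral => A mA _; exact: PQ.
by rewrite (ge0_integral_pushforward mphi)//.
Qed.

Lemma coupling_fst nu mu pi : coupling nu mu pi ->
  forall A : set (borel X), measurable A -> pi (fst @^-1` A) = nu A.
Proof.
move=> cpi A /cpi[<- _]; congr (pi _).
by apply/seteqP; split => z //= -[].
Qed.

Lemma coupling_snd nu mu pi : coupling nu mu pi ->
  forall A : set (borel X), measurable A -> pi (snd @^-1` A) = mu A.
Proof.
move=> cpi A /cpi[_ <-]; congr (pi _).
by apply/seteqP; split => z //= -[].
Qed.

Lemma bm_fst (f : borel X -> R) : bounded_measurable f ->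
  bounded_measurable (fun z : borel X * borel X => f z.1).
Proof.
by move=> [mf [M fM]]; split; [exact: measurableT_comp|exists M => z].
Qed.

Lemma bm_snd (f : borel X -> R) : bounded_measurable f ->
  bounded_measurable (fun z : borel X * borel X => f z.2).
Proof.
by move=> [mf [M fM]]; split; [exact: measurableT_comp|exists M => z].
Qed.

(** The easy half of Kantorovich duality: the pointwise bound is integrated against an almost
    optimal coupling. *)
Lemma transport_dual_le alpha nu mu (f g : borel X -> R) (c t : R) :
  separable X -> young_function alpha -> 0 <= c ->
  bounded_measurable f -> bounded_measurable g ->
  (forall x y : X, f x - g y <= c * alpha (mdist x y)) ->
  (transport_cost alpha nu mu <= t%:E)%E ->
  \int[nu]_x f x - \int[mu]_x g x <= c * t.
Proof.
move=> sX Ya c0 bf bg fg ct; apply/ler_addgt0Pr => e e0.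
(* The coupling is taken optimal up to [e / (c + 1)]; the [+ 1] covers the case [c = 0]. *)
have cc : 0 < c + 1 by rewrite ltr_wpDl.
have [_ [pi cpi <-] Ipi] : exists2 I, [set \int[pi]_z (alpha (mdist (z.1 : X) (z.2 : X)))%:E
    | pi in coupling nu mu]%E I & (I < (t + e / (c + 1))%:E)%E.
  apply/ereal_inf_ltP; apply: le_lt_trans ct _.
  by rewrite lte_fin ltrDl divr_gt0.
have mc := measurable_cost sX Ya.
have c_ge0 z : 0 <= alpha (mdist z.1 z.2) by move=> *; exact: young_ge0 Ya _.
have ic : pi.-integrable setT (EFin \o (fun z : borel X * borel X => alpha (mdist (z.1 : X) (z.2 : X)))).
  apply/integrableP; split; first exact/measurable_EFinP.
  under eq_integral do rewrite /= ger0_norm//.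
  exact: lt_trans Ipi (ltry _).
have iZ : pi.-integrable setT
    (EFin \o (fun z : borel X * borel X => c * alpha (mdist (z.1 : X) (z.2 : X)))).
  rewrite (_ : _ \o _ = fun z => (c%:E * (alpha (mdist (z.1 : X) (z.2 : X)))%:E)%E)//.
  exact: integrableZl.
rewrite -(int_image _ (coupling_fst cpi))//.
rewrite -(int_image _ (coupling_snd cpi))//.
rewrite -intB; [|exact: bm_fst|exact: bm_snd].
apply: (@le_trans _ _ (\int[pi]_z (c * alpha (mdist (z.1 : X) (z.2 : X))))).
  apply: le_Rintegral => //.
  by apply: bm_integrable; apply: bmB; [exact: bm_fst|exact: bm_snd].
rewrite RintegralZl//.
have : \int[pi]_z alpha (mdist (z.1 : X) (z.2 : X)) <= t + e / (c + 1).
  rewrite -lee_fin /Rintegral fineK ?(ltW Ipi)//.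
  exact: integrable_fin_num ic.
move=> /(ler_wpM2l c0)/le_trans; apply.
rewrite mulrDr lerD2l mulrCA ler_piMr ?(ltW e0)// ler_pdivrMr// mul1r lerDl//.
Qed.

Lemma relative_entropy_density nu mu (r : borel X -> R) :
  measurable_fun setT r -> (forall x, 0 <= r x) ->
  is_density nu mu r -> relative_entropy nu mu = (\int[nu]_x lne (r x)%:E)%E.
Proof.
move=> mr r0 rnu; rewrite /relative_entropy asboolT; last exact: density_dominates rnu.
exact: integral_lne_density.
Qed.

Lemma relative_entropy_exp_density nu mu (w : borel X -> R) : bounded_measurable w ->
  is_density nu mu (fun x => expR (w x) / \int[mu]_x expR (w x)) ->
  relative_entropy nu mu = (\int[nu]_x w x - ln (\int[mu]_x expR (w x)))%:E.
Proof.
move=> bw dw; have Z0 := int_expR_gt0 mu bw.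
rewrite (relative_entropy_density _ _ dw).
- exact: integral_lne_exp_density.
- by apply: measurable_funM; [exact: (bm_expR bw).1|exact: measurable_cst].
- by move=> x; rewrite divr_ge0 ?expR_ge0// ltW.
Qed.

Lemma int_exp_density nu mu (w f : borel X -> R) : bounded_measurable w -> bounded_measurable f ->
  is_density nu mu (fun x => expR (w x) / \int[mu]_x expR (w x)) ->
  \int[nu]_x f x = (\int[mu]_x (f x * expR (w x))) / \int[mu]_x expR (w x).
Proof.
move=> bw bf dw; have Z0 := int_expR_gt0 mu bw.
have be := bm_expR bw.
have bd : bounded_measurable (fun x => expR (w x) / \int[mu]_x expR (w x)).
  by apply: bmM => //; exact: bm_cst.
rewrite (int_density bd _ dw)//; last by move=> x; rewrite divr_ge0 ?expR_ge0// ltW.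
under eq_Rintegral do rewrite mulrA mulrC.
by rewrite intZ; [rewrite mulrC|exact: bmM].
Qed.

(** The entropy of the function [e^w] under [mu]: its mass times the relative entropy of its
    normalisation. *)
Definition exp_entropy mu (w : borel X -> R) : R :=
  \int[mu]_x (w x * expR (w x)) - (\int[mu]_x expR (w x)) * ln (\int[mu]_x expR (w x)).

(* Transporting [e^w mu / Z] to [mu] turns [\int w d(nu - mu)] into the transport of [w]. *)
Lemma tau_log_sobolev alpha mu (C L : R) (w psi : borel X -> R) :
  separable X -> young_function alpha -> transport_entropy alpha C mu -> 0 <= L ->
  bounded_measurable w -> bounded_measurable psi ->
  (forall x y : X, w x - w y <= psi x + L * alpha (mdist x y)) ->
  (1 - L * C) * exp_entropy mu w <= \int[mu]_x (psi x * expR (w x)).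
Proof.
move=> sX Ya Tmu L0 bw bpsi H.
have [nu dnu] := exp_density_exists mu bw.
have Z0 := int_expR_gt0 mu bw.
set Z := \int[mu]_x expR (w x) in dnu Z0 *.
set h := \int[nu]_x w x - ln Z.
have := @transport_dual_le alpha nu mu (fun x => w x - psi x) w L (C * h) sX Ya L0.
have -> : (transport_cost alpha nu mu <= (C * h)%:E)%E.
  by have := Tmu nu; rewrite (relative_entropy_exp_density bw dnu) -EFinM.
have bd := bmB bw bpsi.
move=> /(_ bd bw) Hd.
have {}Hd : \int[nu]_x (w x - psi x) - \int[mu]_x w x <= L * (C * h).
  by apply: Hd => // x y; rewrite lerBlDr lerBlDl addrA -lerBlDr addrC; have := H x y; lra.
(* Jensen bounds the [mu]-integral of [w] by [ln Z], so [h] is at most the difference of the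
   integrals of [w] under [nu] and [mu]; the transport term [L C h] then moves to the left. *)
have J := jensen_ln mu bw.
have : (1 - L * C) * h <= \int[nu]_x psi x.
  by move: Hd; rewrite intB// /h; move: J; rewrite -/Z; lra.
have EE : exp_entropy mu w = Z * h.
  rewrite /exp_entropy /h (int_exp_density bw bw dnu) -/Z mulrBr mulrCA.
  by rewrite mulfV ?gt_eqF// mulr1.
rewrite EE (int_exp_density bw bpsi dnu) -/Z ler_pdivlMr//; lra.
Qed.

End coupling_theory.

(** * Perturbation by a bounded potential *)

Section tilting.
Context {R : realType} {X : completeMetricType R}.
Variables (mu : probability (borel X) R) (phi : {mfun borel X >-> R}).
Hypothesis bnd_phi : bounded_fun (phi : borel X -> R^o).

Lemma bm_phi : bounded_measurable (phi : borel X -> R).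
Proof.
split; first exact: measurable_funP.
have [M [_ HM]] := bnd_phi; exists (M + 1) => x.
by apply: (HM (M + 1) _ x I); rewrite ltrDl.
Qed.

Let Z := \int[mu]_x expR (phi x).

Lemma tilt_density :
  is_density (tilt mu phi) mu (fun x => expR (phi x) / \int[mu]_x expR (phi x)).
Proof.
move=> A mA; rewrite tiltE//.
have Z0 : 0 < Z := int_expR_gt0 mu bm_phi.
rewrite -ge0_integralZl_EFin//.
- by apply: eq_integral => x _; rewrite -EFinM mulrC.
- by apply/measurable_EFinP/measurable_funTS; exact: (bm_expR bm_phi).1.
- by rewrite invr_ge0 ltW.
Qed.

Lemma phi_le_sup x : phi x <= sup (range phi).
Proof.
have [_ [M fM]] := bm_phi; apply: ub_le_sup; last by exists x.
by exists M => _ [y _ <-]; exact: le_trans (ler_norm _) _.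
Qed.

Lemma inf_le_phi x : inf (range phi) <= phi x.
Proof.
have [_ [M fM]] := bm_phi; apply: ge_inf; last by exists x.
by exists (- M) => _ [y _ <-]; have := fM y; rewrite ler_norml => /andP[].
Qed.

Lemma xlnx_ge (a t : R) : 0 < a -> 0 < t -> 0 <= a * (ln a - ln t) - a + t.
Proof.
move=> a0 t0; have := @le_ln1Dx _ (t / a - 1).
rewrite subrKC ln_div ?posrE// ltrBrDl subrr divr_gt0// => /(_ isT).
move=> /(ler_wpM2l (ltW a0)).
rewrite [a * (t / a - 1)]mulrBr mulr1 [a * (t / a)]mulrC divfK ?gt_eqF//; lra.
Qed.

(* Holley and Stroock: the entropy is the minimum over [t] of the integral of the nonnegative
   function [e^w (w - ln t) - e^w + t]. *)
Lemma exp_entropy_tilt_le (w : borel X -> R) : bounded_measurable w ->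
  exp_entropy (tilt mu phi) w <= expR (sup (range phi)) / Z * exp_entropy mu w.
Proof.
move=> bw; have be := bm_expR bw; have bwe := bmM bw be.
set t := \int[mu]_x expR (w x).
have t0 : 0 < t := int_expR_gt0 mu bw.
have Z0 : 0 < Z := int_expR_gt0 mu bm_phi.
pose F x := w x * expR (w x) - ln t * expR (w x) - expR (w x) + t.
have blt := bmZ (ln t) be; have b1 := bmB bwe blt; have b2 := bmB b1 be.
have bF : bounded_measurable F by apply: bmD => //; exact: bm_cst.
have F0 x : 0 <= F x.
  have := xlnx_ge (expR_gt0 (w x)) t0; rewrite expRK /F; lra.
have intF (P : probability (borel X) R) : \int[P]_x F x =
    \int[P]_x (w x * expR (w x)) - ln t * \int[P]_x expR (w x) - \int[P]_x expR (w x) + t.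
  by rewrite /F intD ?int_cst//; [rewrite intB// intB// intZ|exact: bm_cst].
(* [F] is built with the mean [t] under [mu], which is optimal for [mu] but not for [tilt]: hence an
   inequality here and an equality below. *)
apply: (@le_trans _ _ (\int[tilt mu phi]_x F x)).
  rewrite intF /exp_entropy.
  have := xlnx_ge (int_expR_gt0 (tilt mu phi) bw) t0; lra.
have -> : exp_entropy mu w = \int[mu]_x F x.
  by rewrite intF /exp_entropy -/t; ring.
rewrite (int_exp_density bm_phi bF tilt_density) -/Z mulrAC ler_wpM2r ?invr_ge0 ?(ltW Z0)//.
rewrite -intZ//; apply: int_le; [|exact: bmZ|].
  by apply: bmM => //; exact: bm_expR bm_phi.
move=> x; rewrite mulrC ler_wpM2r// ler_expR; exact: phi_le_sup.
Qed.

(** The upper bound of the density is spent on the entropy and the lower bound on the right-hand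
    side, where [psi >= 0] is needed; [Z] cancels and [e^(sup - inf)] remains. *)
Lemma tilt_tau_log_sobolev alpha (C L : R) (w psi : borel X -> R) :
  separable X -> young_function alpha -> transport_entropy alpha C mu ->
  0 <= L -> L * C < 1 ->
  bounded_measurable w -> bounded_measurable psi -> (forall x, 0 <= psi x) ->
  (forall x y : X, w x - w y <= psi x + L * alpha (mdist x y)) ->
  exp_entropy (tilt mu phi) w <=
  expR (Osc phi) / (1 - L * C) * \int[tilt mu phi]_x (psi x * expR (w x)).
Proof.
move=> sX Ya Tmu L0 LC bw bpsi psi0 H.
have Z0 : 0 < Z := int_expR_gt0 mu bm_phi.
have LC0 : 0 < 1 - L * C by rewrite subr_gt0.
apply: le_trans (exp_entropy_tilt_le bw) _.
have := tau_log_sobolev sX Ya Tmu L0 bw bpsi H.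
rewrite -ler_pdivlMl// => /le_trans Hent.
have bpe := bmM bpsi (bm_expR bw).
apply: (@le_trans _ _ (expR (sup (range phi)) / Z * ((1 - L * C)^-1 * \int[mu]_x (psi x * expR (w x))))).
  apply: ler_wpM2l; first by rewrite divr_ge0 ?expR_ge0// ltW.
  exact: Hent.
rewrite (int_exp_density bm_phi bpe tilt_density) -/Z.
rewrite /Osc expRB [leRHS](_ : _ = expR (sup (range phi)) / Z * ((1 - L * C)^-1 *
  ((expR (inf (range phi)))^-1 * \int[mu]_x (psi x * expR (w x) * expR (phi x))))); last by ring.
apply: ler_wpM2l; first by rewrite divr_ge0 ?expR_ge0// ltW.
apply: ler_wpM2l; first by rewrite invr_ge0 ltW.
rewrite -intZ; last by apply: bmM => //; exact: bm_expR bm_phi.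
apply: int_le => //; first by apply: bmZ; apply: bmM => //; exact: bm_expR bm_phi.
move=> x; rewrite mulrCA -[leLHS]mulr1 ler_wpM2l//; first by rewrite mulr_ge0 ?expR_ge0.
by rewrite ler_pdivlMl ?expR_gt0// mulr1 ler_expR inf_le_phi.
Qed.

End tilting.

(** * From the logarithmic Sobolev inequality to the dual transport inequality *)

Section scalar_estimates.
Context {R : realType}.
Implicit Types (u w x q d E : R).

Lemma subr_expRN_ge u : 0 <= u -> u - u ^+ 2 <= 1 - expR (- u).
Proof.
move=> u0; have u1 : 0 < 1 + u by rewrite ltr_pwDl.
rewrite lerBrDl -lerBrDr expRN.
have : (expR u)^-1 <= (1 + u)^-1.
  by rewrite lef_pV2 ?posrE ?expR_gt0// expR_ge1Dx.
move=> /le_trans; apply; rewrite -div1r ler_pdivrMr//.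
have : 0 <= u ^+ 3 by rewrite exprn_ge0.
rewrite (_ : u ^+ 3 = u * u ^+ 2) ?exprS//; lra.
Qed.

Lemma subr_expRN_le u : 1 - expR (- u) <= u.
Proof. by have := expR_ge1Dx (- u); lra. Qed.

Lemma expR_sub1_le x : 0 <= x -> x <= 2^-1 -> expR x - 1 <= x + 2 * x ^+ 2.
Proof.
move=> x0 x1; have x2 : 0 < 1 - x by lra.
have : expR x <= (1 - x)^-1.
  rewrite -[expR x]invrK -expRN lef_pV2 ?posrE ?expR_gt0//.
  exact: expR_ge1Dx.
move=> H; rewrite lerBlDl (le_trans H)// -div1r ler_pdivrMr//.
have : 0 <= x ^+ 2 * (1 - 2 * x) by rewrite mulr_ge0 ?exprn_even_ge0//; lra.
lra.
Qed.

Lemma ln1D_ge w : 0 <= w -> w - w ^+ 2 <= ln (1 + w).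
Proof.
move=> w0; have w1 : 0 < 1 + w by rewrite ltr_pwDl.
have := @le_ln1Dx _ ((1 + w)^-1 - 1).
rewrite subrKC lnV ?posrE// ltrBrDl subrr invr_gt0 => /(_ w1).
have : (1 + w)^-1 <= 1 - w + w ^+ 2.
  rewrite -div1r ler_pdivrMr//.
  have : 0 <= w ^+ 3 by rewrite exprn_ge0.
  rewrite (_ : w ^+ 3 = w * w ^+ 2) ?exprS//; lra.
lra.
Qed.

(* Consistency error of the implicit Euler scheme for [d ln lambda = E d ln k]. *)
Lemma euler_consistency q d E E1 : 0 < q -> 0 <= d -> q * d <= 2^-1 ->
  0 <= E -> E <= E1 ->
  - (q * E1 + (q + q ^+ 2) * E1 ^+ 2 + 2 * q ^+ 2 * E1) * d ^+ 2 <=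
  1 - expR (- (q * ln (1 + E * (1 - expR (- d))))) - (expR (q * d) - 1) * E.
Proof.
move=> q0 d0 qd E0 EE1; have q0' := ltW q0.
set w := E * (1 - expR (- d)).
have dd0 : 0 <= 1 - expR (- d) by rewrite subr_ge0 expR_le1 oppr_le0.
have w0 : 0 <= w by rewrite mulr_ge0.
have wle : w <= E * d by rewrite ler_wpM2l// subr_expRN_le.
have wge : E * (d - d ^+ 2) <= w by rewrite ler_wpM2l// subr_expRN_ge.
have w2 : w ^+ 2 <= E ^+ 2 * d ^+ 2 by rewrite -exprMn lerXn2r// nnegrE ?mulr_ge0.
have l0 : 0 <= ln (1 + w) by rewrite ln_ge0// lerDl.
have lle : ln (1 + w) <= w by rewrite le_ln1Dx// (lt_le_trans _ w0)// ltrN10.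
have lge := ln1D_ge w0.
set u := q * ln (1 + w).
have u0 : 0 <= u by rewrite mulr_ge0.
have uge : q * (w - w ^+ 2) <= u by rewrite ler_wpM2l.
have u2 : u ^+ 2 <= q ^+ 2 * w ^+ 2.
  by rewrite -exprMn lerXn2r// ?nnegrE ?mulr_ge0// ler_wpM2l.
have U := subr_expRN_ge u0.
have V := ler_wpM2r E0 (expR_sub1_le (mulr_ge0 q0' d0) qd).
have w2' := ler_wpM2l q0' w2; have wge' := ler_wpM2l q0' wge.
have w2'' := ler_wpM2l (exprn_ge0 2 q0') w2.
have d20 : 0 <= d ^+ 2 by rewrite exprn_ge0.
have E2 : E ^+ 2 <= E1 ^+ 2 by rewrite lerXn2r// nnegrE (le_trans E0).
have T1 : q * E * d ^+ 2 <= q * E1 * d ^+ 2 by rewrite ler_wpM2r// ler_wpM2l.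
have T2 : (q + q ^+ 2) * E ^+ 2 * d ^+ 2 <= (q + q ^+ 2) * E1 ^+ 2 * d ^+ 2.
  by rewrite ler_wpM2r// ler_wpM2l// addr_ge0// exprn_ge0.
have T3 : 2 * q ^+ 2 * E * d ^+ 2 <= 2 * q ^+ 2 * E1 * d ^+ 2.
  by rewrite ler_wpM2r// ler_wpM2l// mulr_ge0// exprn_ge0.
lra.
Qed.

End scalar_estimates.

(** * Sup-convolutions of a bounded function *)

Section sup_convolution.
Context {R : realType} {X : completeMetricType R}.
Variables (alpha : R -> R) (f : borel X -> R) (M : R).
Hypotheses (Ya : young_function alpha) (fM : forall x, `|f x| <= M).
Implicit Types (l : R) (x y z : X).

Definition sup_conv l x := sup (range (fun y : X => f y - l * alpha (mdist x y))).

Lemma sup_conv_ub l x : 0 <= l ->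
  has_ubound (range (fun y : X => f y - l * alpha (mdist x y))).
Proof.
move=> l0; exists M => _ [y _ <-]; rewrite lerBlDr.
apply: (le_trans (ler_norm _)); apply: (le_trans (fM y)).
by rewrite lerDl mulr_ge0// (young_ge0 Ya).
Qed.

Lemma sup_conv_ge l x y : 0 <= l -> f y - l * alpha (mdist x y) <= sup_conv l x.
Proof. by move=> l0; apply: ub_le_sup; [exact: sup_conv_ub|exists y]. Qed.

Lemma sup_conv_adherent l x e : 0 <= l -> 0 < e ->
  exists y, sup_conv l x - e < f y - l * alpha (mdist x y).
Proof.
move=> l0 e0; have [_ [y _ <-] H] : exists2 v,
    range (fun y : X => f y - l * alpha (mdist x y)) v & sup_conv l x - e < v.
  apply: sup_adherent => //; split; last exact: sup_conv_ub.
  by exists (f x - l * alpha (mdist x x)), x.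
by exists y.
Qed.

Lemma sup_conv_le l x c : (forall y, f y - l * alpha (mdist x y) <= c) ->
  sup_conv l x <= c.
Proof.
move=> H; apply: ge_sup; first by exists (f x - l * alpha (mdist x x)), x.
by move=> _ [y _ <-].
Qed.

Lemma le_sup_conv l x : 0 <= l -> f x <= sup_conv l x.
Proof.
move=> l0; have := @sup_conv_ge l x x l0.
by rewrite mdistxx (young0 Ya) mulr0 subr0.
Qed.

Lemma sup_conv_homo l l' x : 0 <= l -> l <= l' -> sup_conv l' x <= sup_conv l x.
Proof.
move=> l0 ll'; apply: sup_conv_le => y; apply: le_trans (sup_conv_ge _ y l0).
by rewrite lerB// ler_wpM2r// (young_ge0 Ya).
Qed.

Lemma sup_conv_le_bound l x : 0 <= l -> sup_conv l x <= M.
Proof.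
move=> l0; apply: sup_conv_le => y; rewrite lerBlDr.
apply: (le_trans (ler_norm _)); apply: (le_trans (fM y)).
by rewrite lerDl mulr_ge0// (young_ge0 Ya).
Qed.

Lemma bm_sup_conv l : 0 < l -> bounded_measurable (sup_conv l : borel X -> R).
Proof.
move=> l0; split; last first.
  exists M => x; rewrite ler_norml (sup_conv_le_bound _ (ltW l0)) andbT.
  by apply: le_trans (le_sup_conv _ (ltW l0)); have := fM x; rewrite ler_norml => /andP[].
apply: measurable_gt_fun => a.
(* The supremum is uncountable, but its superlevel sets are unions of open sets. *)
suff : open [set x : X | a < sup_conv l x] by exact: borel_open.
rewrite (_ : [set x | _] = \bigcup_(y : X) [set x | alpha (mdist x y) < (f y - a) / l]).
  by apply: bigcup_open => y _; exact: open_cost_lt.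
apply/seteqP; split => [x /= ax|x [y _ /=]].
  have [y] := @sup_conv_adherent l x (sup_conv l x - a) (ltW l0) ltac:(by rewrite subr_gt0).
  rewrite subKr => H; exists y => //=.
  by rewrite ltr_pdivlMr// mulrC; move: H; lra.
rewrite ltr_pdivlMr// mulrC => H; apply: lt_le_trans (sup_conv_ge x y (ltW l0)).
by move: H; lra.
Qed.

(** This stands for minus the derivative in [l], which by the envelope principle would be
    [alpha (mdist x y)] at a maximiser [y]. *)
Definition sup_conv_slope l l' x := (sup_conv l x - sup_conv l' x) / (l' - l).

Lemma sup_conv_slope_ge0 l l' x : 0 <= l -> l < l' -> 0 <= sup_conv_slope l l' x.
Proof.
move=> l0 ll'; have := sup_conv_homo x l0 (ltW ll').
by rewrite -subr_ge0 => /divr_ge0; apply; rewrite subr_ge0 ltW.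
Qed.

(** An almost maximiser [y] for [l] satisfies [l alpha (mdist x y) <= 2 M] up to a small error,
    because [f x <= sup_conv l x]; [1 <= l] then removes [l]. The bound is uniform as [l' - l] tends
    to 0. *)
Lemma sup_conv_slope_le l l' x : 1 <= l -> l < l' -> sup_conv_slope l l' x <= 2 * M.
Proof.
move=> l1 ll'; have l0 : 0 <= l := le_trans ler01 l1.
have l'0 : 0 <= l' by rewrite (le_trans l0)// ltW.
have ll'0 : 0 < l' - l by rewrite subr_gt0.
rewrite ler_pdivrMr//; apply/ler_addgt0Pr => e e0.
have e0' : 0 < e / (1 + (l' - l)) by rewrite divr_gt0// addr_gt0.
have [y Hy] := sup_conv_adherent x l0 e0'.
have H' := sup_conv_ge x y l'0.
have a0 : 0 <= alpha (mdist x y) := young_ge0 Ya _.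
have fx : f x <= sup_conv l x := le_sup_conv x l0.
have : alpha (mdist x y) <= 2 * M + e / (1 + (l' - l)).
  apply: (@le_trans _ _ (l * alpha (mdist x y))); first by rewrite ler_peMl.
  have := fM x; have := fM y; rewrite !ler_norml => /andP[? ?] /andP[? ?].
  by move: Hy; lra.
move=> /(ler_wpM2r (ltW ll'0)).
have : e / (1 + (l' - l)) * (l' - l) + e / (1 + (l' - l)) = e.
  by field; rewrite gt_eqF// addr_gt0.
by move: Hy H'; lra.
Qed.

Lemma bm_sup_conv_slope l l' : 0 < l -> l < l' ->
  bounded_measurable (sup_conv_slope l l' : borel X -> R).
Proof.
move=> l0 ll'; apply: bmM; last exact: bm_cst.
by apply: bmB; apply: bm_sup_conv => //; exact: lt_trans ll'.
Qed.

(* An almost optimal [y] in the definition of [sup_conv l' x] satisfies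
   [alpha (mdist x y) <= sup_conv_slope l l' x], up to a small error. *)
Lemma sup_conv_increment_le l l' x z c s : 0 <= l -> l < l' -> 0 <= c ->
  (forall u v, 0 <= u -> 0 <= v ->
     alpha (u + v) - alpha u <= c * alpha u + s * alpha v) ->
  sup_conv l' x - sup_conv l' z <=
  l' * c * sup_conv_slope l l' x + l' * s * alpha (mdist x z).
Proof.
move=> l0 ll' c0 H; have l'0 : 0 < l' by apply: le_lt_trans ll'.
have ll'0 : 0 < l' - l by rewrite subr_gt0.
(* The error [e / t] occurs once as it is and once multiplied by [l' c / (l' - l)]; this [t] makes
   the total exactly [e]. *)
apply/ler_addgt0Pr => e e0; pose t := 1 + l' * c / (l' - l).
have l'c : 0 <= l' * c by rewrite mulr_ge0// ltW.
have t0 : 0 < t by rewrite ltr_pwDl// divr_ge0// ltW.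
have [y Hy] := sup_conv_adherent x (ltW l'0) (divr_gt0 e0 t0).
have Hl := sup_conv_ge x y l0; have Hz := sup_conv_ge z y (ltW l'0).
have Ha : alpha (mdist x y) <= sup_conv_slope l l' x + e / t / (l' - l).
  rewrite /sup_conv_slope -mulrDl ler_pdivlMr//.
  by move: Hy Hl; lra.
have az : alpha (mdist z y) <= alpha (mdist x y + mdist x z).
  apply: (young_homo Ya); first exact: mdist_ge0.
  by rewrite [mdist x z]metric_sym; exact: mdist_lipschitz.
have := H _ _ (mdist_ge0 x y) (mdist_ge0 x z) => Hxz.
have Hzy : alpha (mdist z y) <=
    alpha (mdist x y) + (c * alpha (mdist x y) + s * alpha (mdist x z)).
  by apply: le_trans az _; rewrite -lerBlDl.
have K1 := ler_wpM2l (ltW l'0) Hzy.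
have K2 := ler_wpM2l (mulr_ge0 (ltW l'0) c0) Ha.
have : e / t + l' * c * (e / t / (l' - l)) = e.
  rewrite /t; field; rewrite !gt_eqF//; first by rewrite ltr_wpDr.
by move: Hy Hz K1 K2; lra.
Qed.

End sup_convolution.

(** * Monotonicity of the exponential mean along the curve *)

Section hypercontractivity.
Context {R : realType} {X : completeMetricType R}.
Variables (P : probability (borel X) R) (alpha : R -> R) (A L q e1 b : R).
Hypotheses (Ya : young_function alpha) (A0 : 0 < A) (L0 : 0 < L) (q0 : 0 < q).
Hypotheses (e10 : 0 < e1) (b0 : 0 < b).
Hypothesis growth : forall u v e, 0 <= u -> 0 <= v -> 0 < e -> e <= e1 ->
  alpha (u + v) - alpha u <= b * e * alpha u + expR (- q * ln e) * alpha v.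
Hypothesis LSI : forall w psi : borel X -> R,
  bounded_measurable w -> bounded_measurable psi -> (forall x, 0 <= psi x) ->
  (forall x y : X, w x - w y <= psi x + L * alpha (mdist x y)) ->
  exp_entropy P w <= A * \int[P]_x (psi x * expR (w x)).
Variables (f g : borel X -> R) (M : R).
Hypotheses (bf : bounded_measurable f) (bg : bounded_measurable g).
Hypotheses (fM : forall x, `|f x| <= M).
Hypothesis fg : forall x y : X, f x - g y <= alpha (mdist x y).

Let h := sup_conv alpha f.
Let logint k l := ln (\int[P]_x expR (k * h l x)) / k.

(** Gibbs' inequality and the logarithmic Sobolev inequality are both used at the primed end, as in
    an implicit scheme. The gain [l' - l] and the entropy loss then multiply the same integral [J]
    of the slope, and [J <= 2 M Z'] turns the defect [D] into the error. *)
Lemma logint_step (k k' l l' e D : R) : 0 < k -> k <= k' -> 1 <= l -> l < l' ->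
  0 < e -> e <= e1 -> k' * l' * expR (- q * ln e) = L ->
  - D <= (l' - l) - (k' / k - 1) * (A * b * e) * l' -> 0 <= D ->
  logint k' l' <= logint k l + 2 * M * D.
Proof.
move=> k0 kk' l1 ll' e0 ee1 kle HD D0.
have k'0 : 0 < k' := lt_le_trans k0 kk'.
have l0 : 0 < l := lt_le_trans ltr01 l1.
have l'0 : 0 < l' := lt_trans l0 ll'.
have bh : bounded_measurable (h l : borel X -> R) := bm_sup_conv Ya fM l0.
have bh' : bounded_measurable (h l' : borel X -> R) := bm_sup_conv Ya fM l'0.
have bw := bmZ k bh; have bw' := bmZ k' bh'.
have be' := bm_expR bw'.
have bD := bm_sup_conv_slope Ya fM l0 ll'.
set D' := sup_conv_slope alpha f l l' in bD.
have D'0 x : 0 <= D' x by apply: (sup_conv_slope_ge0 Ya fM) => //; exact: ltW.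
have D'M x : D' x <= 2 * M by apply: (sup_conv_slope_le Ya fM).
set Z := \int[P]_x expR (k * h l x); set Z' := \int[P]_x expR (k' * h l' x).
have Z0 : 0 < Z := int_expR_gt0 P bw.
have Z'0 : 0 < Z' := int_expR_gt0 P bw'.
set J := \int[P]_x (D' x * expR (k' * h l' x)).
have J0 : 0 <= J by apply: Rintegral_ge0 => x _; rewrite mulr_ge0 ?expR_ge0.
have JM : J <= 2 * M * Z'.
  rewrite -intZ//; apply: int_le; [exact: bmM|exact: bmZ|].
  by move=> x; rewrite ler_wpM2r ?expR_ge0.
have Hent : exp_entropy P (fun x => k' * h l' x) <= A * (k' * (l' * (b * e)) * J).
  rewrite -intZ; last exact: bmM.
  under eq_Rintegral do rewrite mulrA.
  apply: LSI => //; first exact: bmZ.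
    by move=> x; apply: mulr_ge0 => //; rewrite !mulr_ge0// ltW.
  move=> x y; rewrite -mulrBr.
  have H u v : 0 <= u -> 0 <= v ->
    alpha (u + v) - alpha u <= b * e * alpha u + expR (- q * ln e) * alpha v.
    by move=> u0 v0; exact: growth.
  have := sup_conv_increment_le Ya fM x y (ltW l0) ll' (mulr_ge0 (ltW b0) (ltW e0)) H.
  move=> /(ler_wpM2l (ltW k'0)) /le_trans; apply.
  by rewrite -kle le_eqVlt; apply/orP; left; apply/eqP; rewrite /D'; ring.
have := gibbs_ln P bw bw'; rewrite -/Z -/Z'.
(* The exponents differ by [k (h_l - h_l') - (1 - k / k') k' h_l']: the first term produces the
   slope, the second the entropy. *)
have -> : \int[P]_x ((k * h l x - k' * h l' x) * expR (k' * h l' x)) =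
   k * ((l' - l) * J) - (1 - k / k') * \int[P]_x (k' * h l' x * expR (k' * h l' x)).
  have bDe := bmM bD be'; have bwe := bmM bw' be'.
  rewrite mulrA /J -(intZ P _ bDe) -(intZ P _ bwe) -intB; [|exact: bmZ|exact: bmZ].
  apply: eq_Rintegral => x _; rewrite /D' /sup_conv_slope -/h.
  by field; rewrite !gt_eqF// subr_gt0.
have EE : \int[P]_x (k' * h l' x * expR (k' * h l' x)) =
   exp_entropy P (fun x => k' * h l' x) + Z' * ln Z'.
  by rewrite /exp_entropy -/Z'; ring.
rewrite EE => G.
rewrite /logint -/Z -/Z' -(ler_pM2l k0) -(ler_pM2r Z'0).
have kk1 : 0 <= 1 - k / k' by rewrite subr_ge0 ler_pdivrMr// mul1r.
have G2 := ler_wpM2l kk1 Hent.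
have HD2 := ler_wpM2r J0 (ler_wpM2l (ltW k0) HD).
have JM2 := ler_wpM2l (mulr_ge0 (ltW k0) D0) JM.
have -> : k * (ln Z / k + 2 * M * D) * Z' = ln Z * Z' + k * D * (2 * M * Z').
  by field; rewrite gt_eqF.
have -> : k * (ln Z' / k') * Z' = ln Z' * Z' - (1 - k / k') * (Z' * ln Z').
  by field; rewrite gt_eqF.
clearbody J Z Z'; have E3 : (1 - k / k') * (A * (k' * (l' * (b * e)) * J)) =
  k * ((k' / k - 1) * (A * b * e) * l') * J.
  by field; rewrite !gt_eqF.
rewrite E3 in G2; move: G G2 HD2 JM2.
move: (exp_entropy _ _) (ln Z) (ln Z') => Ent lZ lZ' G G2 HD2 JM2; lra.
Qed.

Let B := A * b.
(** The solution of [y / (1 - B y) = e1], the largest [y] for which [e] stays in the range of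
    [growth]. *)
Let y1 := e1 / (1 + B * e1).
Let k1 := L * expR (q * ln y1).

Let Bgt0 : 0 < B. Proof. exact: mulr_gt0. Qed.
Let B0 : 0 <= B. Proof. exact: ltW. Qed.
Let Be0 : 0 < 1 + B * e1. Proof. by rewrite ltr_pwDl// mulr_ge0// ltW. Qed.
Let y10 : 0 < y1. Proof. exact: divr_gt0. Qed.

(** Logarithmic time turns ratios of [k] into exponentials of time differences; as [s] grows, [kk]
    and [ll] decrease to 0 and 1. *)
Let yy s := y1 * expR (- s).
Let kk s := k1 * expR (- (q * s)).
Let ll s := expR (- (q * ln (1 - B * yy s))).

Let yy_gt0 s : 0 < yy s. Proof. by rewrite mulr_gt0 ?expR_gt0. Qed.

Let yy_le s : 0 <= s -> yy s <= y1.
Proof. by move=> s0; rewrite ler_piMr ?(ltW y10)// expR_le1 oppr_le0. Qed.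

Let By1 : 1 - B * y1 = (1 + B * e1)^-1.
Proof. by rewrite /y1; field; rewrite gt_eqF. Qed.

Let Byy_ge s : 0 <= s -> (1 + B * e1)^-1 <= 1 - B * yy s.
Proof. by move=> s0; rewrite -By1 lerB// ler_wpM2l// yy_le. Qed.

Let Byy_gt0 s : 0 <= s -> 0 < 1 - B * yy s.
Proof. by move=> s0; rewrite (lt_le_trans _ (Byy_ge s0))// invr_gt0. Qed.

Let ee s := yy s / (1 - B * yy s).

Let ee_le s : 0 <= s -> ee s <= e1.
Proof.
move=> s0; rewrite ler_pdivrMr ?Byy_gt0//.
have := yy_le s0; rewrite /y1 ler_pdivlMr//; lra.
Qed.

Let ll_ge1 s : 0 <= s -> 1 <= ll s.
Proof.
move=> s0; rewrite -expR0 ler_expR oppr_ge0 mulr_ge0_le0 ?(ltW q0)//.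
by rewrite ln_le0// lerBlDr lerDl mulr_ge0// ltW.
Qed.

Let ll_le s : 0 <= s -> ll s <= expR (q * ln (1 + B * e1)).
Proof.
move=> s0; rewrite ler_expR -mulrN ler_pM2l// -lnV ?posrE ?Byy_gt0//.
rewrite ler_ln ?posrE ?invr_gt0 ?Byy_gt0//.
by rewrite invf_ple ?posrE ?Byy_gt0// Byy_ge.
Qed.

Let kk_gt0 s : 0 < kk s. Proof. by rewrite !mulr_gt0 ?expR_gt0. Qed.

Let kle s : 0 <= s -> kk s * ll s * expR (- q * ln (ee s)) = L.
Proof.
move=> s0; have lnee : ln (ee s) = ln y1 - s - ln (1 - B * yy s).
  rewrite ln_div ?posrE ?yy_gt0 ?Byy_gt0//.
  by rewrite {1}/yy lnM ?posrE ?expR_gt0// expRK.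
rewrite lnee /kk /ll -[RHS]mulr1 -expR0 -[k1 * _ * _]mulrA -[k1 * _ * _]mulrA -[L * _ * _]mulrA.
rewrite -!expRD; congr (L * expR _); ring.
Qed.

Let F s := logint (kk s) (ll s).

Let F_step : exists D, forall s t, 0 <= s -> s <= t -> t - s <= (2 * q)^-1 ->
  F s <= F t + D * (t - s) ^+ 2.
Proof.
(* The constant of [euler_consistency] for [E1 = B e1], which bounds [B * ee s]. Steps of length at
   most [1 / (2 q)] meet its hypothesis [q d <= 1/2]. *)
pose c := q * (B * e1) + (q + q ^+ 2) * (B * e1) ^+ 2 + 2 * q ^+ 2 * (B * e1).
have Be10 : 0 <= B * e1 by rewrite mulr_ge0// ltW.
have c0 : 0 <= c.
  rewrite !addr_ge0// !mulr_ge0 ?exprn_ge0 ?addr_ge0 ?exprn_ge0// ltW//.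
pose lM := expR (q * ln (1 + B * e1)).
exists (2 * M * (lM * c)) => s t s0 st tsq.
have [<-|neq_st] := eqVneq s t; first by rewrite subrr expr0n/= mulr0 addr0.
have {neq_st st}st : s < t by rewrite lt_neqAle neq_st.
have t0 : 0 <= t by rewrite (le_trans s0)// ltW.
set d := t - s in tsq *; have d0 : 0 < d by rewrite subr_gt0.
have tE : t = s + d by rewrite /d; ring.
have yE : yy t = yy s * expR (- d) by rewrite /yy tE opprD expRD mulrA.
have qd : q * d <= 2^-1.
  by rewrite -ler_pdivlMl// -invfM mulrC.
have kE : kk s / kk t = expR (q * d).
  rewrite /kk -mulf_div divff ?gt_eqF ?mulr_gt0 ?expR_gt0// mul1r -expRB.
  by congr expR; rewrite /d; ring.
have Es0 : 0 <= B * ee s by rewrite mulr_ge0// divr_ge0// ltW// Byy_gt0.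
have Ese : B * ee s <= B * e1 by rewrite ler_wpM2l// ee_le.
have lE : ll t = ll s * expR (- (q * ln (1 + B * ee s * (1 - expR (- d))))).
  rewrite /ll -expRD; congr expR.
  have -> : 1 - B * yy t = (1 - B * yy s) * (1 + B * ee s * (1 - expR (- d))).
    by rewrite yE /ee; field; rewrite gt_eqF// Byy_gt0.
  rewrite lnM ?posrE ?Byy_gt0//; first by ring.
  rewrite ltr_pwDl// mulr_ge0// subr_ge0 expR_le1 oppr_le0 ltW//.
have EC := euler_consistency q0 (ltW d0) qd Es0 Ese.
have lls0 : 0 < ll s by exact: expR_gt0.
rewrite -[X in _ + X]mulrA; apply: (@logint_step (kk t) (kk s) (ll t) (ll s) (ee s)) => //.
- rewrite /kk ler_pM2l ?mulr_gt0 ?expR_gt0// ler_expR lerN2 ler_pM2l// ltW//.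
- exact: ll_ge1.
- rewrite lE -[ltRHS]mulr1 ltr_pM2l// expR_lt1 oppr_lt0 mulr_gt0// ln_gt0// ltrDl.
  apply: mulr_gt0; last by rewrite subr_gt0 expR_lt1 oppr_lt0.
  by rewrite mulr_gt0// divr_gt0// Byy_gt0.
- by rewrite divr_gt0// Byy_gt0.
- exact: ee_le.
- exact: kle.
- rewrite kE lE.
  have := ler_wpM2l (ltW lls0) EC.
  have : ll s * (c * d ^+ 2) <= lM * c * d ^+ 2.
    rewrite -mulrA ler_wpM2r ?ll_le// mulr_ge0// exprn_ge0// ltW//.
  rewrite -/c -/B; lra.
- apply: mulr_ge0; last by rewrite exprn_ge0// ltW.
  by apply: mulr_ge0 => //; exact: expR_ge0.
Qed.

Let F_decr S : 0 <= S -> F 0 <= F S.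
Proof.
move=> S0; have [D HD] := F_step.
apply: (@le_of_quadratic_drop _ F 0 S D (2 * q)^-1) => //.
  by rewrite invr_gt0 mulr_gt0.
by move=> s t s0 st _ tsq; exact: HD.
Qed.

Let sup_conv_le_g l x : 1 <= l -> h l x <= g x.
Proof.
move=> l1; apply: sup_conv_le => // y; rewrite lerBlDr -lerBlDl.
apply: le_trans (fg y x) _; rewrite metric_sym.
by rewrite ler_peMl// (young_ge0 Ya).
Qed.

(** For small [k], [e^(k g) <= 1 + k g + 2 (k G)^2] and [ln Z <= Z - 1]; the sup-convolution is
    replaced by [g], which dominates it as soon as [l >= 1]. *)
Let F_le s (G : R) : 0 <= s -> (forall x, `|g x| <= G) -> kk s * G <= 2^-1 ->
  F s <= \int[P]_x g x + 2 * kk s * G ^+ 2.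
Proof.
move=> s0 gG kG; have k0 := kk_gt0 s.
have l0 : 0 < ll s by exact: expR_gt0.
have bh : bounded_measurable (h (ll s) : borel X -> R) := bm_sup_conv Ya fM l0.
have bkh := bmZ (kk s) bh; have bkg := bmZ (kk s) bg.
rewrite /F /logint ler_pdivrMr//.
have b2 : bounded_measurable (fun x => kk s * g x + 2 * (kk s * G) ^+ 2).
  by apply: bmD => //; exact: bm_cst.
have : \int[P]_x expR (kk s * h (ll s) x) <= 1 + \int[P]_x (kk s * g x + 2 * (kk s * G) ^+ 2).
  rewrite -[X in X + _](int_cst P) -intD//; last exact: bm_cst.
  apply: int_le; [exact: bm_expR|by apply: bmD => //; exact: bm_cst|].
  move=> x; apply: (@le_trans _ _ (expR (kk s * g x))).
    by rewrite ler_expR ler_pM2l// sup_conv_le_g// ll_ge1.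
  have gx : `|kk s * g x| <= kk s * G by rewrite normrM gtr0_norm// ler_pM2l.
  have : (kk s * g x) ^+ 2 <= (kk s * G) ^+ 2.
    by rewrite -[X in X <= _]real_normK ?num_real// lerXn2r// nnegrE (le_trans _ gx).
  have [u0|u0] := leP 0 (kk s * g x).
    have := @expR_sub1_le _ _ u0; rewrite (le_trans (ler_norm _) (le_trans gx kG)) => /(_ isT).
    by lra.
  have := @subr_expRN_ge _ (- (kk s * g x)); rewrite oppr_ge0 opprK sqrrN (ltW u0) => /(_ isT).
  by have := sqr_ge0 (kk s * G); lra.
move=> H; have Z0 := int_expR_gt0 P bkh.
have : ln (\int[P]_x expR (kk s * h (ll s) x)) <= \int[P]_x expR (kk s * h (ll s) x) - 1.
  by rewrite -{1}[\int[P]_x expR _](subrKC 1) le_ln1Dx// ltrBrDl subrr.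
move=> /le_trans; apply; rewrite lerBlDl (le_trans H)// lerD2l intD//; last exact: bm_cst.
rewrite intZ// int_cst; lra.
Qed.

Lemma tau_log_sobolev_dual :
  ln (\int[P]_x expR (k1 * f x)) <= k1 * \int[P]_x g x.
Proof.
have k10 : 0 < k1 by rewrite mulr_gt0// expR_gt0.
have bh : bounded_measurable (h (ll 0) : borel X -> R) := bm_sup_conv Ya fM (expR_gt0 _).
have bkf := bmZ k1 bf; have bkh := bmZ k1 bh.
apply: (@le_trans _ _ (k1 * F 0)).
  rewrite /F /logint /kk mulr0 oppr0 expR0 mulr1 mulrC divfK ?gt_eqF//.
  rewrite ler_ln ?posrE ?int_expR_gt0//.
  apply: int_le; [exact: bm_expR|exact: bm_expR|] => x.
  by rewrite ler_expR ler_pM2l// (le_sup_conv Ya fM)// expR_ge0.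
rewrite ler_pM2l//; apply/ler_addgt0Pr => e e0.
have [_ [G0 gG0]] := bg; pose G := `|G0| + 1.
have gG x : `|g x| <= G by rewrite (le_trans (gG0 x))// (le_trans (ler_norm _))// lerDl.
have G0' : 0 < G by rewrite ltr_pwDr.
(* The two bounds on [kk S] required by [F_le]: [kk S * G <= 1/2], and a remainder at most [e]. The
   time [S] then comes from solving [k1 e^(- q S) <= c]. *)
pose c := Num.min (G^-1 / 2) (e / (2 * G ^+ 2)).
have c0 : 0 < c by rewrite lt_min !divr_gt0// ?invr_gt0// mulr_gt0// exprn_gt0.
pose S := Num.max 0 (ln (k1 / c) / q).
have S0 : 0 <= S by rewrite le_max lexx.
have kc : kk S <= c.
  have : ln (k1 / c) / q <= S by rewrite le_max lexx orbT.
  rewrite ler_pdivrMr// => H1.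
  have H : k1 <= expR (S * q) * c.
    by rewrite -ler_pdivrMr// -[leLHS]lnK ?posrE ?divr_gt0// ler_expR.
  by rewrite /kk expRN ler_pdivrMr ?expR_gt0// mulrC [q * S]mulrC.
apply: le_trans (F_decr S0) _.
apply: le_trans (F_le S0 gG _) _.
  rewrite -ler_pdivlMr// mulrC (le_trans kc)// ge_min lexx//.
rewrite lerD2l.
have : kk S <= e / (2 * G ^+ 2) by rewrite (le_trans kc)// ge_min lexx orbT.
by rewrite ler_pdivlMr ?mulr_gt0 ?exprn_gt0//; lra.
Qed.

End hypercontractivity.

(** * Kantorovich duality *)

Section finite_partition.
Context {R : realType} d (T : measurableType d).
Implicit Types P : probability T R.

Lemma bm_indic (A : set T) : measurable A -> bounded_measurable (\1_A : T -> R).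
Proof.
move=> mA; split; first exact: measurable_indic.
by exists 1 => x; rewrite indicE; case: (_ \in _); rewrite ?normr1 ?normr0.
Qed.

Lemma int_indic P (A : set T) : measurable A -> \int[P]_x (\1_A x : R) = fine (P A).
Proof. by move=> mA; rewrite /Rintegral integral_indic// setIT. Qed.

Lemma bm_sum (I : Type) (s : seq I) (F : I -> T -> R) :
  (forall i, bounded_measurable (F i)) ->
  bounded_measurable (fun x => \sum_(i <- s) F i x).
Proof.
move=> bF; elim: s => [|i s IH].
  by under eq_fun do rewrite big_nil; exact: bm_cst.
by under eq_fun do rewrite big_cons; exact: bmD.
Qed.

Lemma int_sum P (I : Type) (s : seq I) (F : I -> T -> R) :
  (forall i, bounded_measurable (F i)) ->
  \int[P]_x (\sum_(i <- s) F i x) = \sum_(i <- s) \int[P]_x F i x.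
Proof.
move=> bF; elim: s => [|i s IH].
  by under eq_Rintegral do rewrite big_nil; rewrite big_nil int_cst.
under eq_Rintegral do rewrite big_cons.
by rewrite big_cons intD ?IH//; exact: bm_sum.
Qed.

Variables (I : finType) (c : T -> I).
Hypothesis mc : forall i, measurable (c @^-1` [set i]).

Lemma step_sumE (f : I -> R) x :
  f (c x) = \sum_i f i * \1_(c @^-1` [set i]) x.
Proof.
rewrite (bigD1 (c x))//= indicE mem_set// mulr1 big1 ?addr0// => i ix.
rewrite indicE memNset ?mulr0//= => xi.
by rewrite xi eqxx in ix.
Qed.

Lemma bm_step (f : I -> R) : bounded_measurable (fun x => f (c x)).
Proof.
under eq_fun do rewrite step_sumE.
by apply: bm_sum => i; apply: bmZ; exact: bm_indic.
Qed.

Lemma int_step P (f : I -> R) :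
  \int[P]_x f (c x) = \sum_i f i * fine (P (c @^-1` [set i])).
Proof.
under eq_Rintegral do rewrite step_sumE.
rewrite int_sum; last by move=> i; apply: bmZ; exact: bm_indic.
by apply: eq_bigr => i _; rewrite intZ ?int_indic//; exact: bm_indic.
Qed.

Lemma partition_mass P (A : set T) : measurable A ->
  \sum_i fine (P (A `&` c @^-1` [set i])) = fine (P A).
Proof.
move=> mA; rewrite -int_indic//.
have E x : (\1_A x : R) = \sum_i \1_(A `&` c @^-1` [set i]) x.
  rewrite (bigD1 (c x))//= [X in _ + X]big1 ?addr0.
    rewrite !indicE; congr (_%:R); congr (nat_of_bool _).
    by apply/idP/idP => /set_mem H; apply/mem_set => //; case: H.
  move=> i ix; rewrite indicE memNset//= => -[_ xi].
  by rewrite xi eqxx in ix.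
under eq_Rintegral do rewrite E.
rewrite int_sum => [|i]; last by apply: bm_indic; exact: measurableI.
by apply: eq_bigr => i _; rewrite int_indic//; exact: measurableI.
Qed.

End finite_partition.

(** * From a finite plan to a coupling *)

Section gluing.
Context {R : realType} d1 d2 (T1 : measurableType d1) (T2 : measurableType d2).
Variables (nu : probability T1 R) (mu : probability T2 R).
Variables (n m : nat) (c1 : T1 -> 'I_n) (c2 : T2 -> 'I_m).
Hypothesis mc1 : forall i, measurable (c1 @^-1` [set i]).
Hypothesis mc2 : forall j, measurable (c2 @^-1` [set j]).
Variable w : 'I_n -> 'I_m -> R.
Hypothesis w0 : forall i j, 0 <= w i j.
Let u i := fine (nu (c1 @^-1` [set i])).
Let v j := fine (mu (c2 @^-1` [set j])).
Hypothesis wu : forall i, \sum_j w i j = u i.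
Hypothesis wv : forall j, \sum_i w i j = v j.

Let t i j := w i j / (u i * v j).

Let w_le_u i j : w i j <= u i.
Proof. by rewrite -wu (bigD1 j)//= lerDl sumr_ge0. Qed.

Let w_le_v i j : w i j <= v j.
Proof. by rewrite -wv (bigD1 i)//= lerDl sumr_ge0. Qed.

Let tuv i j : t i j * u i * v j = w i j.
Proof.
rewrite /t; have [u0|u0] := eqVneq (u i) 0.
  rewrite u0 mulr0 mul0r; apply/esym/le_anti; rewrite w0 andbT.
  by rewrite -u0 w_le_u.
have [v0|v0] := eqVneq (v j) 0.
  rewrite v0 mulr0; apply/esym/le_anti; rewrite w0 andbT.
  by rewrite -v0 w_le_v.
by field; rewrite u0 v0.
Qed.

Let theta (z : T1 * T2) := t (c1 z.1) (c2 z.2).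

Let theta0 z : 0 <= theta z.
Proof. by rewrite divr_ge0// mulr_ge0// fine_ge0. Qed.

Let rect i j : set (T1 * T2) := (c1 @^-1` [set i]) `*` (c2 @^-1` [set j]).

Let theta_sumE z : theta z = \sum_i \sum_j t i j * \1_(rect i j) z.
Proof.
rewrite /theta (step_sumE c1 (fun i => t i (c2 z.2))); apply: eq_bigr => i _.
rewrite (step_sumE c2 (fun j => t i j)) mulr_suml; apply: eq_bigr => j _.
rewrite -mulrA; congr (_ * _); rewrite !indicE -natrM mulnb; congr (_%:R); congr (nat_of_bool _).
by apply/andP/idP => [[/set_mem H1 /set_mem H2]|/set_mem [H1 H2]]; [exact/mem_set|split; exact/mem_set].
Qed.

Let mrect i j : measurable (rect i j). Proof. exact: measurableX. Qed.

Let bm_theta : bounded_measurable theta.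
Proof.
rewrite (_ : theta = fun z => \sum_i \sum_j t i j * \1_(rect i j) z); last exact/funext.
by apply: bm_sum => i; apply: bm_sum => j; apply: bmZ; exact: bm_indic.
Qed.

Let theta_rect (A : set T1) (B : set T2) : measurable A -> measurable B ->
  (\int[(nu \x mu)%E]_(z in A `*` B) (theta z)%:E)%E =
  (\sum_i \sum_j t i j * (fine (nu (A `&` c1 @^-1` [set i])) * fine (mu (B `&` c2 @^-1` [set j]))))%:E.
Proof.
move=> mA mB; have mAB := measurableX mA mB.
rewrite integral_mkcond epatch_indic.
under eq_integral do rewrite -EFinM.
rewrite int_EFin; last by apply: bmM => //; exact: bm_indic.
congr EFin.
have E z : theta z * \1_(A `*` B) z =
    \sum_i \sum_j t i j * \1_((A `&` c1 @^-1` [set i]) `*` (B `&` c2 @^-1` [set j])) z.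
  rewrite theta_sumE mulr_suml; apply: eq_bigr => i _.
  rewrite mulr_suml; apply: eq_bigr => j _.
  rewrite -mulrA; congr (_ * _); rewrite !indicE -natrM mulnb; congr (_%:R); congr (nat_of_bool _).
  apply/andP/idP => [[/set_mem[? ?] /set_mem[? ?]]|/set_mem [[? ?] [? ?]]].
    exact/mem_set.
  by split; exact/mem_set.
have mr i j : measurable ((A `&` c1 @^-1` [set i]) `*` (B `&` c2 @^-1` [set j])).
  by apply: measurableX; exact: measurableI.
under eq_Rintegral do rewrite E.
rewrite int_sum; last by move=> i; apply: bm_sum => j; apply: bmZ; exact: bm_indic.
apply: eq_bigr => i _.
rewrite int_sum; last by move=> j; apply: bmZ; exact: bm_indic.
apply: eq_bigr => j _; rewrite intZ; last exact: bm_indic.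
rewrite int_indic//= product_measure1E ?fineM//; try exact: measurableI.
- by apply: fin_num_measure; exact: measurableI.
- by apply: fin_num_measure; exact: measurableI.
Qed.

Let tv i (A : set T1) : measurable A ->
  \sum_j t i j * (fine (nu (A `&` c1 @^-1` [set i])) * v j) = fine (nu (A `&` c1 @^-1` [set i])).
Proof.
move=> mA; set a := fine _.
have au : a <= u i.
  by apply: fine_le; [exact: fin_num_measure (measurableI _ _ mA (mc1 i))|exact: fin_num_measure|
    apply: le_measure; rewrite ?inE//; exact: measurableI].
have a0 : 0 <= a by rewrite fine_ge0.
have [u0|u0] := eqVneq (u i) 0.
  have -> : a = 0 by apply: le_anti; rewrite a0 andbT -u0.
  by rewrite big1// => j _; rewrite mul0r mulr0.
transitivity (\sum_j w i j * (a / u i)).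
  by apply: eq_bigr => j _; rewrite -tuv; field.
by rewrite -mulr_suml wu mulrC divfK.
Qed.

Let tu j (B : set T2) : measurable B ->
  \sum_i t i j * (u i * fine (mu (B `&` c2 @^-1` [set j]))) = fine (mu (B `&` c2 @^-1` [set j])).
Proof.
move=> mB; set a := fine _.
have av : a <= v j.
  by apply: fine_le; [exact: fin_num_measure (measurableI _ _ mB (mc2 j))|exact: fin_num_measure|
    apply: le_measure; rewrite ?inE//; exact: measurableI].
have a0 : 0 <= a by rewrite fine_ge0.
have [v0|v0] := eqVneq (v j) 0.
  have -> : a = 0 by apply: le_anti; rewrite a0 andbT -v0.
  by rewrite big1// => i _; rewrite !mulr0.
transitivity (\sum_i w i j * (a / v j)).
  by apply: eq_bigr => i _; rewrite -tuv; field.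
by rewrite -mulr_suml wv mulrC divfK.
Qed.

(** On each rectangle of cells the product measure is multiplied by the constant [w / (u v)], and
    the marginals of [w] give those of the result. If [u i] or [v j] vanishes then so does [w i j],
    so the division by zero is harmless. *)
Lemma gluing : exists pi : probability (T1 * T2)%type R,
  [/\ forall A, measurable A -> pi (A `*` setT) = nu A,
      forall B, measurable B -> pi (setT `*` B) = mu B &
      forall i j, pi ((c1 @^-1` [set i]) `*` (c2 @^-1` [set j])) = (w i j)%:E].
Proof.
have fst_marginal A : measurable A ->
    (\int[(nu \x mu)%E]_(z in A `*` setT) (theta z)%:E)%E = nu A.
  move=> mA; rewrite theta_rect// -[RHS]fineK ?fin_num_measure//.
  rewrite -(partition_mass mc1 nu mA); congr EFin.
  apply: eq_bigr => i _; rewrite -[RHS]tv//; apply: eq_bigr => j _.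
  by rewrite setTI.
have snd_marginal B : measurable B ->
    (\int[(nu \x mu)%E]_(z in setT `*` B) (theta z)%:E)%E = mu B.
  move=> mB; rewrite theta_rect// -[RHS]fineK ?fin_num_measure//.
  rewrite -(partition_mass mc2 mu mB); congr EFin.
  rewrite exchange_big /=; apply: eq_bigr => j _; rewrite -[RHS]tu//; apply: eq_bigr => i _.
  by rewrite setTI.
have [|pi dpi] := @density_exists _ _ _ (nu \x mu)%E theta bm_theta.1 theta0.
  by rewrite -setXTT fst_marginal// probability_setT.
exists pi; split => [A mA|B mB|i j].
- by rewrite dpi ?fst_marginal//; exact: measurableX.
- by rewrite dpi ?snd_marginal//; exact: measurableX.
- rewrite (dpi _ (mrect i j)) (theta_rect (mc1 i) (mc2 j)); congr EFin.
  rewrite (bigD1 i)//= [X in _ + X]big1 ?addr0; last first.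
    move=> k ki; apply: big1 => j' _; rewrite (_ : _ `&` _ = set0) ?measure0 ?mul0r ?mulr0//.
    by apply/seteqP; split => x //= [-> ik]; rewrite ik eqxx in ki.
  rewrite (bigD1 j)//= [X in _ + X]big1 ?addr0; last first.
    move=> k ki; rewrite [X in mu X](_ : _ `&` _ = set0) ?measure0 ?mulr0//.
    by apply/seteqP; split => x //= [-> ik]; rewrite ik eqxx in ki.
  by rewrite !setIid mulrA tuv.
Qed.

End gluing.

(** * Kantorovich duality under a moment condition *)

Section kantorovich.
Context {R : realType} {X : completeMetricType R}.
Implicit Types (mu nu : probability (borel X) R) (alpha : R -> R).

Lemma tail_integral d (T : measurableType d) (P : probability T R) (a : T -> R)
    (F : (set T)^nat) (e : R) :
  measurable_fun setT a -> (forall x, 0 <= a x) ->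
  (\int[P]_x (a x)%:E < +oo)%E ->
  (forall n, measurable (F n)) -> nondecreasing_seq F -> \bigcup_n F n = setT ->
  0 < e -> exists n, forall m, (n <= m)%N -> (\int[P]_(x in ~` F m) (a x)%:E <= e%:E)%E.
Proof.
move=> ma a0 afin mF ndF UF e0.
have mEa : measurable_fun setT (EFin \o a) by exact/measurable_EFinP.
have := @ge0_nondecreasing_set_cvg_integral _ _ _ F (EFin \o a) P ndF mF.
rewrite UF => /(_ (fun i => measurable_funTS mEa) (fun _ _ _ => a0 _)).
set I := (\int[P]_(x in [set: T]) _)%E => cvgI.
have I0 : (0 <= I)%E by apply: integral_ge0 => x _; rewrite lee_fin.
have Ifin : I \is a fin_num by rewrite ge0_fin_numE.
have : \forall n \near \oo, (I - e%:E < \int[P]_(x in F n) (EFin \o a) x)%E.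
  apply: (cvgI [set y | I - e%:E < y]%E).
  have : (I - e%:E < I)%E by rewrite -[I]fineK// -EFinB lte_fin ltrBlDr ltrDl.
  by move=> H; apply: open_nbhs_nbhs; split => //; exact: open_ereal_gt_ereal.
move=> [n _ Hn]; exists n => m nm; have {Hn} := Hn m nm => /= Hm.
have : I = (\int[P]_(x in F m) (a x)%:E + \int[P]_(x in ~` F m) (a x)%:E)%E.
  rewrite -ge0_integral_setU//.
  - by rewrite setUv.
  - exact: measurableC.
  - exact: measurable_funTS.
  - by move=> x _; rewrite lee_fin.
  - by rewrite disj_set2E setICr.
move: Hm; set u := (\int[P]_(x in F m) _)%E; set v := (\int[P]_(x in ~` F m) _)%E.
have u0 : (0 <= u)%E by apply: integral_ge0 => x _; rewrite lee_fin.
have v0 : (0 <= v)%E by apply: integral_ge0 => x _; rewrite lee_fin.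
move=> Hu Iuv.
have uf : u \is a fin_num.
  by rewrite ge0_fin_numE//; apply: le_lt_trans afin; rewrite -/I Iuv leeDl.
have vf : v \is a fin_num.
  by rewrite ge0_fin_numE//; apply: le_lt_trans afin; rewrite -/I Iuv leeDr.
move: Hu Iuv; rewrite -(fineK uf) -(fineK vf) -(fineK Ifin) -EFinB -EFinD lte_fin lee_fin => H [].
move: H; lra.
Qed.

Lemma measurable_mdist_le (x0 : X) (r : R) :
  measurable ([set x | mdist x x0 <= r] : set (borel X)).
Proof.
rewrite (_ : [set _ | _] = ~` [set x | r < mdist x x0]); last first.
  by apply/seteqP; split => x /=; rewrite leNgt => /negP.
apply: measurableC; apply: borel_open; apply: open_mdist_cond => x xr.
exists (mdist x x0 - r); first by rewrite subr_gt0.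
move=> x' xx'; have := mdist_lipschitz x x' x0; move: xx'; lra.
Qed.

Lemma measurable_find (s : seq X) (e : R) i :
  measurable ([set x | find (fun y => mdist x y < e) s = i] : set (borel X)).
Proof.
elim: s i => [|y s IH] [|i] /=.
- by rewrite (_ : [set _ | _] = setT)//; apply/seteqP; split.
- by rewrite (_ : [set _ | _] = set0)//; apply/seteqP; split.
- rewrite (_ : [set _ | _] = [set x | mdist x y < e]).
    by apply: borel_open; exact: open_mdist_lt.
  by apply/seteqP; split => x /=; case: ifPn.
- rewrite (_ : [set _ | _] = (~` [set x | mdist x y < e]) `&`
    [set x | find (fun y => mdist x y < e) s = i]).
    apply: measurableI; last exact: IH.
    by apply: measurableC; apply: borel_open; exact: open_mdist_lt.
  apply/seteqP; split => x /=; first by case: ifPn => // /negP xy [].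
  by move=> [/negP/negbTE -> ->].
Qed.

(** A finite subcover of the compact ball, made disjoint by labelling a point with the first small
    ball that contains it; [ord_max] labels the complement of the large ball. *)
Lemma ball_partition (x0 : X) (r e : R) : compact_closed_balls X -> 0 < e ->
  exists n (c : borel X -> 'I_n.+1),
    [/\ forall i, measurable (c @^-1` [set i]),
        forall x : X, mdist x0 x <= r <-> c x != ord_max &
        forall x y : X, c x = c y -> c x != ord_max -> mdist x y <= 2 * e].
Proof.
move=> cX e0.
have := cX x0 r; rewrite compact_cover => /(_ X setT (fun y => [set x | mdist x y < e])).
case=> [y _|x _|D _ cD]; first exact: open_mdist_lt.
  by exists x => //=; rewrite mdistxx.
pose s := finmap.enum_fset D; pose find_s x := find (fun y : X => mdist x y < e) s.
pose c' x := if mdist x x0 <= r then find_s x else size s.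
have c'_lt x : mdist x0 x <= r <-> (c' x < size s)%N.
  rewrite /c' metric_sym; split => [xr|]; last by case: ifPn => //; rewrite ltnn.
  rewrite xr -has_find; apply/hasP.
  have [|y yD /= xy] := cD x; first by rewrite /= metric_sym.
  by exists y.
have c'_le x : (c' x < (size s).+1)%N.
  by rewrite ltnS /c'; case: ifPn => // _; exact: find_size.
exists (size s), (fun x => Ordinal (c'_le x)); split.
- move=> i; rewrite (_ : _ @^-1` _ = [set x | c' x = i]); last first.
    by apply/seteqP; split => x /= [H]; [rewrite -H|exact: val_inj].
  have mB := measurable_mdist_le x0 r.
  rewrite (_ : [set x | _] = ([set x | mdist x x0 <= r] `&` [set x | find_s x = i]) `|`
    (~` [set x | mdist x x0 <= r] `&` [set x | size s = i])).
    apply: measurableU; first by apply: measurableI => //; exact: measurable_find.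
    apply: measurableI; first exact: measurableC.
    have [si|si] := eqVneq (size s) i.
      by rewrite (_ : [set _ | _] = setT)//; apply/seteqP; split.
    by rewrite (_ : [set _ | _] = set0)//; apply/seteqP; split => x //= /eqP; rewrite (negbTE si).
  apply/seteqP; split => x /=; rewrite /c'.
    by case: ifPn => xr H; [left|right; split => //; exact/negP].
  by move=> [[->]|[/negP/negbTE ->]].
- move=> x; rewrite c'_lt -val_eqE /= ltn_neqAle; split => [/andP[]//|->] /=.
  exact: c'_le.
- move=> x y [cxy]; rewrite -val_eqE /= => cx.
  have xs : (c' x < size s)%N by rewrite ltn_neqAle cx /=; exact: c'_le.
  have close z : (c' z < size s)%N -> mdist z (nth x0 s (c' z)) < e.
    move=> zs; have zr := (c'_lt z).2 zs.
    move: zs; rewrite /c' metric_sym zr -has_find => zs.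
    exact: (nth_find x0 zs).
  have := close x xs; have := close y; rewrite -cxy => /(_ xs) yz xz.
  have := metric_triangle x (nth x0 s (c' x)) y.
  rewrite [mdist (nth _ _ _) y]metric_sym; lra.
Qed.

Lemma kantorovich_le alpha nu mu (x0 : X) (V : R) :
  separable X -> compact_closed_balls X -> young_function alpha -> Delta2 alpha ->
  (\int[nu]_x (alpha (mdist (x : X) x0))%:E < +oo)%E ->
  (\int[mu]_x (alpha (mdist (x : X) x0))%:E < +oo)%E ->
  (forall f g : borel X -> R, bounded_measurable f -> bounded_measurable g ->
    (forall x y : X, f x - g y <= alpha (mdist x y)) ->
    \int[nu]_x f x - \int[mu]_x g x <= V) ->
  (transport_cost alpha nu mu <= V%:E)%E.
Proof.
move=> sX cX Ya D2 nufin mufin HV.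
have [K K1 HK] := young_quasi_triangle Ya D2.
have K0 : 0 < K := lt_le_trans ltr01 K1.
have a_ge0 := young_ge0 Ya.
pose a (x : borel X) := alpha (mdist (x : X) x0).
have ma : measurable_fun setT a.
  by apply: measurable_lt_fun => r; apply: borel_open; exact: open_cost_lt.
apply/lee_addgt0Pr => e e0.
pose F (n : nat) := [set x : borel X | mdist (x : X) x0 <= n%:R].
have mF n : measurable (F n) by exact: measurable_mdist_le.
have ndF : nondecreasing_seq F.
  move=> n m nm; apply/subsetPset => x /=; rewrite /F /= => /le_trans; apply.
  by rewrite ler_nat.
have UF : \bigcup_n F n = setT.
  apply/seteqP; split => // x _; exists (Num.truncn (mdist (x : X) x0)).+1 => //.
  exact/ltW/truncnS_gt.
(* The budget: the tails cost [2 K (e' + e') = e / 2], and the mesh [eta] below costs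
   [l (4 eta) = e / 2]. *)
pose e' := e / (8 * K).
have e'0 : 0 < e' by rewrite divr_gt0// mulr_gt0.
have [n1 Hn1] := tail_integral ma (fun x => a_ge0 _) nufin mF ndF UF e'0.
have [n2 Hn2] := tail_integral ma (fun x => a_ge0 _) mufin mF ndF UF e'0.
pose n := maxn n1 n2.
have {}Hn1 := Hn1 n (leq_maxl _ _); have {}Hn2 := Hn2 n (leq_maxr _ _).
pose r : R := n%:R; have r0 : 0 <= r by [].
pose l := alpha (2 * r + 1) + 1; have l0 : 0 < l by rewrite ltr_wpDl.
pose eta := e / (8 * l); have eta0 : 0 < eta by rewrite divr_gt0// mulr_gt0.
have [N [c [mc cin cdiam]]] := ball_partition x0 r cX eta0.
(* Taking the infimum over a pair of cells makes step potentials admissible for [cc] admissible for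
   [alpha], so that [HV] applies to them. Empty cells get a value that no pair [(c x, c y)]
   meets. *)
pose cc (i j : 'I_N.+1) : R := inf [set t |
  exists x y : X, [/\ c x = i, c y = j & t = alpha (mdist x y)]].
have cc_lb x y : has_lbound [set t |
    exists x' y' : X, [/\ c x' = c x, c y' = c y & t = alpha (mdist x' y')]].
  by exists 0 => _ [x' [y' [_ _ ->]]].
have cc_le (x y : X) : cc (c x) (c y) <= alpha (mdist x y).
  by apply: ge_inf => //; exists x, y.
have cc_ge (x y : X) t : (forall x' y' : X, c x' = c x -> c y' = c y -> t <= alpha (mdist x' y')) ->
    t <= cc (c x) (c y).
  move=> H; apply: lb_le_inf; first by exists (alpha (mdist x y)), x, y.
  by move=> _ [x' [y' [cx cy ->]]]; exact: H.
pose u i := fine (nu (c @^-1` [set i])); pose v i := fine (mu (c @^-1` [set i])).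
have sum1 (P : probability (borel X) R) : \sum_i fine (P (c @^-1` [set i])) = 1.
  have := partition_mass mc P measurableT.
  rewrite [X in _ = fine X -> _](_ : _ = 1%E); last exact: probability_setT.
  by move=> H; rewrite -[RHS]/(fine 1%E) -H; apply: eq_bigr => i _; rewrite setTI.
have [||||f g fgc|w [w0 wu wv wV]] := @finite_kantorovich R _ _ (@ord_max N) (@ord_max N) u v cc V.
- by move=> i; exact: fine_ge0.
- by move=> i; exact: fine_ge0.
- exact: sum1.
- exact: sum1.
- rewrite -!int_step//; apply: HV; [exact: bm_step|exact: bm_step|].
  by move=> x y; apply: le_trans (fgc _ _) (cc_le _ _).
have [pi [pi1 pi2 pi12]] := gluing mc mc w0 wu wv.
have cpi : coupling nu mu pi by move=> A mA; split; [exact: pi1|exact: pi2].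
apply: (@le_trans _ _ (\int[pi]_z (alpha (mdist (z.1 : X) (z.2 : X)))%:E)%E).
  by apply: ereal_inf_lbound; exists pi.
pose tau := (a \_ (~` F n)) : borel X -> R.
have tau0 x : 0 <= tau x by rewrite /tau patchE; case: ifPn => // _; exact: a_ge0.
have mtau : measurable_fun setT tau.
  apply: (measurable_restrictT a (measurableC (mF n))).1.
  exact: measurable_funTS.
have tauE (P : probability (borel X) R) :
    (\int[P]_x (tau x)%:E = \int[P]_(x in ~` F n) (a x)%:E)%E.
  by rewrite [RHS]integral_mkcond restrict_EFin.
(* With both points in the ball, the oscillation over the cells is at most [e / 2]. Otherwise the
   cost is at most [K (a x + a y)], and a point inside has [a <= alpha r], which is at most [tau] of
   the point outside: hence the factor 2. *)
have pointwise x y : alpha (mdist (x : X) (y : X)) <= cc (c x) (c y) + e / 2 + 2 * K * (tau x + tau y).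
  have [/andP[xin yin]|xyout] := boolP ((c x != ord_max) && (c y != ord_max)).
    have t0 : 0 <= 2 * K * (tau x + tau y) by rewrite mulr_ge0 ?addr_ge0// mulr_ge0// ltW.
    apply: (@le_trans _ _ (cc (c x) (c y) + e / 2)); last by rewrite lerDl.
    rewrite -lerBlDr; apply: cc_ge => x' y' cx' cy'.
    have dx : mdist x x' <= 2 * eta by apply: cdiam.
    have dy : mdist y y' <= 2 * eta by apply: cdiam.
    have xr := (cin x).2 xin; have yr := (cin y).2 yin.
    have T1 := metric_triangle (x : X) x0 y; rewrite [mdist _ x0]metric_sym in T1.
    have T2 := metric_triangle (x : X) x' y; have T3 := metric_triangle x' y' (y : X).
    rewrite [mdist y' y]metric_sym in T3.
    have [le1|lt1] := leP (mdist (x : X) y) (mdist x' y').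
      apply: (@le_trans _ _ (alpha (mdist (x : X) y))); first by rewrite lerBlDr lerDl ltW// divr_gt0.
      by apply: (young_homo Ya) => //; exact: mdist_ge0.
    have := @young_lipschitz _ _ Ya (2 * r) (mdist (x : X) y) (mdist x' y') (mdist_ge0 _ _) (ltW lt1).
    have -> : mdist (x : X) y <= 2 * r by move: T1 xr yr; lra.
    move=> /(_ isT) L.
    have : alpha (2 * r + 1) * (mdist (x : X) y - mdist x' y') <= l * (4 * eta).
      apply: ler_pM => //; first by rewrite subr_ge0 ltW.
        by rewrite lerDl.
      by move: T2 T3 dx dy; lra.
    have -> : l * (4 * eta) = e / 2 by rewrite /eta; field; rewrite gt_eqF.
    by move: L; lra.
  have outside z : c z = ord_max -> alpha r <= a z /\ tau z = a z.
    move=> cz; have zr : r < mdist z x0.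
      by rewrite ltNge metric_sym; apply/negP => /cin; rewrite cz eqxx.
    split; first by apply: (young_homo Ya) => //; exact: ltW.
    by rewrite /tau patchE mem_set//= /F/= => H; move: zr; rewrite ltNge H.
  have inside z : c z != ord_max -> a z <= alpha r.
    move=> /cin; rewrite metric_sym => zr.
    by apply: (young_homo Ya) => //; exact: mdist_ge0.
  have cc0 : 0 <= cc (c x) (c y) by apply: cc_ge.
  have xyK : alpha (mdist (x : X) y) <= K * (a x + a y).
    apply: le_trans (HK _ _ (mdist_ge0 _ _) (mdist_ge0 _ _)).
    apply: (young_homo Ya); first exact: mdist_ge0.
    by rewrite [mdist y x0]metric_sym; exact: metric_triangle.
  have : a x + a y <= 2 * (tau x + tau y).
    have tx := tau0 x; have ty := tau0 y.
    have ax := a_ge0 (mdist x x0); have ay := a_ge0 (mdist y x0); rewrite -/(a x) -/(a y) in ax ay.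
    have [/outside[x1 x2]|xin] := eqVneq (c x) ord_max;
    have [/outside[y1 y2]|yin] := eqVneq (c y) ord_max.
    - lra.
    - have := inside _ yin; lra.
    - have := inside _ xin; lra.
    by rewrite xin yin in xyout.
  move=> /(ler_wpM2l (ltW K0)); move: xyK e0 cc0; lra.
pose pc (z : borel X * borel X) := (c z.1, c z.2).
have pcE p : pc @^-1` [set p] = (c @^-1` [set p.1]) `*` (c @^-1` [set p.2]).
  case: p => i j; apply/seteqP; split => -[x y] /= [].
    by move=> -> ->.
  by rewrite /pc /= => -> ->.
have mpc p : measurable (pc @^-1` [set p]) by rewrite pcE; exact: measurableX.
pose S z := cc (c z.1) (c z.2) + e / 2.
have bcc := bm_step mpc (fun p => cc p.1 p.2).
have bS : bounded_measurable S by apply: bmD => //; exact: bm_cst.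
have S0 z : 0 <= S z by rewrite addr_ge0 ?cc_ge// divr_ge0// ltW.
have intS : \int[pi]_z S z <= V + e / 2.
  rewrite /S intD ?int_cst//; last exact: bm_cst.
  rewrite lerD2r (int_step mpc pi (fun p => cc p.1 p.2)).
  apply: le_trans wV; rewrite pair_big /= le_eqVlt; apply/orP; left; apply/eqP.
  by apply: eq_bigr => -[i j] _; rewrite pcE pi12 /= mulrC.
have mt1 : measurable_fun setT (fun z : borel X * borel X => (tau z.1)%:E).
  by apply/measurable_EFinP; exact: measurableT_comp.
have mt2 : measurable_fun setT (fun z : borel X * borel X => (tau z.2)%:E).
  by apply/measurable_EFinP; exact: measurableT_comp.
have mtE : measurable_fun setT (fun x => (tau x)%:E) by exact/measurable_EFinP.
have mS : measurable_fun setT (fun z => (S z)%:E) by apply/measurable_EFinP; case: bS.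
have K20 : (0 <= (2 * K)%:E)%E by rewrite lee_fin mulr_ge0// ltW.
apply: (@le_trans _ _ (\int[pi]_z ((S z)%:E + (2 * K)%:E * ((tau z.1)%:E + (tau z.2)%:E)))%E).
  apply: ge0_le_integral => //.
  - by move=> z _; rewrite lee_fin.
  - by apply/measurable_EFinP; exact: measurable_cost.
  - apply: emeasurable_funD; first exact: mS.
    by apply: measurable_funeM; exact: emeasurable_funD.
  - by move=> [x y] _; rewrite -(EFinD (tau x)) -EFinM -EFinD lee_fin; exact: pointwise.
have mt12 := emeasurable_funD mt1 mt2.
have t0 (z : borel X * borel X) : (0 <= (tau z.1)%:E + (tau z.2)%:E)%E.
  by rewrite adde_ge0// lee_fin.
rewrite (@ge0_integralD _ _ _ pi _ measurableT (fun z => (S z)%:E)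
  (fun z => (2 * K)%:E * ((tau z.1)%:E + (tau z.2)%:E))%E)//.
- rewrite ge0_integralZl// (@ge0_integralD _ _ _ pi _ measurableT
    (fun z => (tau z.1)%:E) (fun z => (tau z.2)%:E))//.
  rewrite int_EFin//.
  rewrite (ge0_integral_image measurable_fst (coupling_fst cpi) mtE)//.
  rewrite (ge0_integral_image measurable_snd (coupling_snd cpi) mtE)//.
  rewrite !tauE.
  apply: (@le_trans _ _ ((V + e / 2)%:E + (2 * K)%:E * (e'%:E + e'%:E))%E).
    apply: leeD; first by rewrite lee_fin.
    by apply: lee_wpmul2l => //; exact: leeD.
  rewrite -(EFinD e') -EFinM -!EFinD lee_fin le_eqVlt; apply/orP; left; apply/eqP.
  by rewrite /e'; field; rewrite gt_eqF.
- by move=> z _; rewrite lee_fin.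
- by move=> z _; rewrite lee_fin.
- by move=> z _; rewrite lee_fin.
- by move=> z _; rewrite mule_ge0.
- exact: measurable_funeM.
Qed.

End kantorovich.

(** * Moments and conclusion *)

Section moments.
Context {R : realType} {X : completeMetricType R}.
Implicit Types (mu nu : probability (borel X) R) (alpha : R -> R).

Lemma bm_minr d (T : measurableType d) (a : T -> R) (M c : R) :
  measurable_fun setT a -> (forall x, c <= a x) ->
  bounded_measurable (fun x => Num.min M (a x)).
Proof.
move=> ma ca; split; first by apply: measurable_minr => //; exact: measurable_cst.
exists (`|M| + `|c|) => x; rewrite ler_norml; apply/andP; split.
  rewrite le_min; apply/andP; split.
    by rewrite lerNl (le_trans (ler_norm _))// normrN lerDl.
  apply: le_trans (ca x); rewrite lerNl (le_trans (ler_norm _))// normrN lerDr//.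
by rewrite ge_min (le_trans (ler_norm M))// lerDl.
Qed.

Lemma integral_lty_of_truncations d (T : measurableType d) (P : probability T R)
    (a : T -> R) (c : R) : measurable_fun setT a -> (forall x, 0 <= a x) ->
  (forall N : nat, \int[P]_x Num.min N%:R (a x) <= c) ->
  (\int[P]_x (a x)%:E < +oo)%E.
Proof.
move=> ma a0 H; apply: (@le_lt_trans _ _ c%:E); last exact: ltry.
pose g (N : nat) x := (Num.min N%:R (a x))%:E.
have bg (N : nat) := bm_minr N%:R ma a0.
have gcvg x : g ^~ x @ \oo --> (a x)%:E.
  apply: cvg_near_cst; exists (Num.truncn (a x)).+1 => // N /= HN.
  congr EFin; apply/min_idPr; apply: (le_trans (ltW (truncnS_gt (a x)))).
  by rewrite ler_nat.
have -> : (\int[P]_x (a x)%:E = \int[P]_x limn (g ^~ x))%E.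
  by apply: eq_integral => x _; apply/esym/cvg_lim => //; exact: gcvg.
have cv : (\int[P]_x g n x)%E @[n --> \oo] --> (\int[P]_x limn (g^~ x))%E.
  apply: cvg_monotone_convergence => //.
  - by move=> N; apply/measurable_EFinP; exact: (bg N).1.
  - by move=> N x _; rewrite lee_fin le_min ler0n a0.
  - by move=> x _ N M NM; rewrite lee_fin le_min !ge_min lexx orbT andbT ler_nat NM.
rewrite -(cvg_lim _ cv)//; apply: lime_le.
  by apply/cvg_ex; eexists; exact: cv.
by apply: nearW => N; rewrite /g int_EFin// lee_fin.
Qed.

Lemma cost_measurable alpha (x0 : X) : young_function alpha ->
  measurable_fun setT (fun x : borel X => alpha (mdist (x : X) x0)).
Proof.
by move=> Ya; apply: measurable_lt_fun => r; apply: borel_open; exact: open_cost_lt.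
Qed.

(* The transport inequality is applied to densities proportional to [exp (- N)] outside a ball
   [B] of mass at least [1/2]: their entropy is at most [ln 2], whereas transporting the mass
   of [mu] that lies far away from [B] is expensive. *)
Lemma transport_entropy_moment alpha mu (C : R) (x0 : X) :
  separable X -> young_function alpha -> Delta2 alpha -> 0 <= C ->
  transport_entropy alpha C mu ->
  (\int[mu]_x (alpha (mdist (x : X) x0))%:E < +oo)%E.
Proof.
move=> sX Ya D2 C0 Tmu; have [K K1 HK] := young_quasi_triangle Ya D2.
have K0 : 0 < K := lt_le_trans ltr01 K1.
have ma := cost_measurable x0 Ya; set a := fun x : borel X => alpha (mdist (x : X) x0) in ma *.
have a0 x : 0 <= a x := young_ge0 Ya _.
pose F (n : nat) := [set x : borel X | mdist (x : X) x0 <= n%:R].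
have mF n : measurable (F n) by exact: measurable_mdist_le.
have ndF : nondecreasing_seq F.
  move=> n m nm; apply/subsetPset => x /=; rewrite /F /= => /le_trans; apply.
  by rewrite ler_nat.
have UF : \bigcup_n F n = setT.
  apply/seteqP; split => // x _; exists (Num.truncn (mdist (x : X) x0)).+1 => //.
  exact/ltW/truncnS_gt.
have h0 : 0 < 2^-1 :> R by rewrite invr_gt0.
have [|n Hn] := @tail_integral R _ _ mu (fun=> 1) F 2^-1 (measurable_cst _) (fun=> ler01) _ mF ndF UF h0.
  by rewrite int_EFin ?int_cst ?ltry//; exact: bm_cst.
pose A := ~` F n; have mA : measurable A by exact: measurableC.
have {Hn}muA : fine (mu A) <= 2^-1.
  have := Hn n (leqnn n); rewrite integral_cst// mul1e => H.
  by rewrite -lee_fin fineK// fin_num_measure.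
have b1A := @bm_indic R _ _ A mA.
(* For [x] in the ball, the quasi-triangle inequality gives [v y <= alpha (mdist x y)]; hence [w]
   and [- min N v] are admissible potentials. *)
pose v x := a x / K - alpha n%:R.
have mv : measurable_fun setT v.
  apply: measurable_funB; last exact: measurable_cst.
  by apply: measurable_funM => //; exact: measurable_cst.
have vge x : - alpha n%:R <= v x by rewrite -[leLHS]add0r lerD2r divr_ge0// ltW.
apply: (@integral_lty_of_truncations _ _ _ _ (K * (C * ln 2 + 2 + alpha n%:R))) => // N.
have bG := bm_minr N%:R mv vge.
pose w (x : borel X) : R := - N%:R * \1_A x.
have bw : bounded_measurable w by exact: bmZ.
have Z2 : 2^-1 <= \int[mu]_x expR (w x).
  apply: (@le_trans _ _ (\int[mu]_x (1 - \1_A x))).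
    rewrite intB//; last exact: bm_cst.
    by rewrite int_cst int_indic//; move: muA; lra.
  apply: int_le; [by apply: bmB => //; exact: bm_cst|exact: bm_expR|].
  move=> x; rewrite /w indicE; case: (_ \in _) => /=; first by rewrite subrr expR_ge0.
  by rewrite mulr0 expR0 subr0.
have [nu dnu] := exp_density_exists mu bw.
set Z := \int[mu]_x expR (w x) in Z2 dnu *.
have Z0 : 0 < Z by apply: lt_le_trans Z2; rewrite invr_gt0.
(* The density of [nu] on [A] is [e^-N / Z], with [N e^-N <= 1] and [1 / Z <= 2]. *)
have nuA : N%:R * \int[nu]_x \1_A x <= 2.
  rewrite (int_exp_density bw b1A dnu) -/Z mulrA ler_pdivrMr//.
  rewrite -intZ; last by apply: bmM => //; exact: bm_expR.
  apply: (@le_trans _ _ 1); last by move: Z2; lra.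
  rewrite -[leRHS](int_cst mu 1); apply: int_le; [|exact: bm_cst|].
    by apply: bmZ; apply: bmM => //; exact: bm_expR.
  move=> x; rewrite /w indicE; case: (_ \in _) => /=; last by rewrite mul0r mulr0.
  rewrite mul1r mulr1 expRN ler_pdivrMr ?expR_gt0// mul1r.
  by apply: le_trans (expR_ge1Dx _); rewrite lerDr.
have w0 x : w x <= 0 by rewrite /w mulNr oppr_le0 mulr_ge0// indicE.
have Hle : relative_entropy nu mu = (\int[nu]_x w x - ln Z)%:E.
  exact: relative_entropy_exp_density.
have hle : \int[nu]_x w x - ln Z <= ln 2.
  have : \int[nu]_x w x <= 0 by rewrite -(int_cst nu 0); apply: int_le => //; exact: bm_cst.
  have : - ln Z <= ln 2.
    by rewrite -lnV ?posrE// ler_ln ?posrE ?invr_gt0// invf_ple ?posrE.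
  lra.
have := @transport_dual_le R X alpha nu mu w (fun x => - Num.min N%:R (v x)) 1
  (C * (\int[nu]_x w x - ln Z)) sX Ya ler01 bw.
have -> : (transport_cost alpha nu mu <= (C * (\int[nu]_x w x - ln Z))%:E)%E.
  by have := Tmu nu; rewrite Hle -EFinM.
have bNG : bounded_measurable (fun x => - Num.min N%:R (v x)).
  by have := bmZ (-1) bG; congr bounded_measurable; apply/funext => x; rewrite mulN1r.
move=> /(_ bNG) H.
have {}H : \int[nu]_x w x - \int[mu]_x - Num.min N%:R (v x) <= C * (\int[nu]_x w x - ln Z).
  rewrite -[leRHS]mul1r; apply: H => // x y; rewrite mul1r opprK.
  rewrite /w indicE; have [/set_mem xA|/negP xA] := boolP (x \in A).
    rewrite mulr1 (le_trans _ (young_ge0 Ya _))// addrC subr_le0 ge_min lexx//.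
  rewrite mulr0 add0r ge_min; apply/orP; right.
  have xn : mdist (x : X) x0 <= n%:R.
    by apply: contrapT => xn; apply: xA; exact: mem_set.
  rewrite /v lerBlDr ler_pdivrMr// mulrC /a.
  apply: (@le_trans _ _ (alpha (mdist x y + mdist x x0))).
    apply: (young_homo Ya); first exact: mdist_ge0.
    by rewrite [mdist x y]metric_sym; exact: metric_triangle.
  apply: le_trans (HK _ _ (mdist_ge0 _ _) (mdist_ge0 _ _)) _.
  rewrite ler_pM2l// lerD2l; apply: (young_homo Ya) => //; exact: mdist_ge0.
have intN : \int[mu]_x - Num.min N%:R (v x) = - \int[mu]_x Num.min N%:R (v x).
  by rewrite -mulN1r -intZ//; apply: eq_Rintegral => x _; rewrite mulN1r.
have intw : \int[nu]_x w x = - (N%:R * \int[nu]_x \1_A x).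
  by rewrite /w intZ// mulNr.
have CZ := ler_wpM2l C0 hle.
have Gle : \int[mu]_x Num.min N%:R (v x) <= C * ln 2 + 2.
  by move: H nuA CZ; rewrite intN intw; lra.
apply: (@le_trans _ _ (\int[mu]_x (K * (Num.min N%:R (v x) + alpha n%:R)))).
  apply: int_le.
  - exact: bm_minr ma a0.
  - by apply: bmZ; apply: bmD => //; exact: bm_cst.
  - move=> x; have [vN|vN] := leP N%:R (v x).
      rewrite ge_min; apply/orP; left.
      apply: (@le_trans _ _ (N%:R + alpha n%:R)); first by rewrite lerDl (young_ge0 Ya).
      by rewrite ler_peMl// addr_ge0// (young_ge0 Ya).
    rewrite ge_min; apply/orP; right.
    by rewrite /v subrK mulrC divfK// gt_eqF.
rewrite intZ; last by apply: bmD => //; exact: bm_cst.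
by rewrite ler_pM2l// intD ?int_cst ?lerD2r//; exact: bm_cst.
Qed.

Lemma dominated_moment d (T : measurableType d) (P Q : probability T R) (r a : T -> R) (M : R) :
  measurable_fun setT r -> (forall x, 0 <= r x) -> 0 <= M -> (forall x, r x <= M) -> is_density Q P r ->
  measurable_fun setT a -> (forall x, 0 <= a x) ->
  (\int[P]_x (a x)%:E < +oo)%E -> (\int[Q]_x (a x)%:E < +oo)%E.
Proof.
move=> mr r0 M0 rM rQ ma a0 afin.
have mEa : measurable_fun setT (fun x => (a x)%:E) by exact/measurable_EFinP.
rewrite (ge0_integral_density mr rQ)//.
apply: (@le_lt_trans _ _ (\int[P]_x (M%:E * (a x)%:E))%E).
  apply: ge0_le_integral => //.
  - by move=> x _; rewrite mule_ge0 ?lee_fin.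
  - by apply: emeasurable_funM => //; exact/measurable_EFinP.
  - exact: measurable_funeM.
  - by move=> x _; rewrite muleC -!EFinM lee_fin ler_wpM2r.
rewrite ge0_integralZl//; last by move=> x _; rewrite lee_fin.
by rewrite lte_mul_pinfty// lee_fin.
Qed.

End moments.

(** * The constant and the conclusion *)

(** With [W = (p / q)^q] one has [b e1 = W - 1], and [A >= 1] gives [1 + A (W - 1) <= A W], the only
    loss. There remains [p C (p A W)^q] with [A = e^O p / q]: the exponent of [p] is
    [1 + 2 q + q^2 = p^2], that of [1 / q] is [q + q^2 = p q]. *)
Lemma dual_constant_le (R : realType) (p C O q L e1 b A : R) :
  1 < p -> 0 < C -> 0 <= O ->
  q = p - 1 -> L = (p * C)^-1 -> e1 = p^-1 ->
  b = (expR (- q * ln (1 - e1)) - 1) / e1 -> A = expR O / (1 - L * C) ->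
  (L * expR (q * ln (e1 / (1 + A * b * e1))))^-1 <= kappa p * C * expR (q * O).
Proof.
move=> p1 C0 O0 qdef Ldef e1def bdef Adef.
have p0 : 0 < p := lt_trans ltr01 p1.
have q0 : 0 < q by rewrite qdef subr_gt0.
have pn0 : p != 0 by rewrite gt_eqF.
have qn0 : q != 0 by rewrite gt_eqF.
have LC : 1 - L * C = q / p by rewrite Ldef qdef; field; rewrite pn0 gt_eqF.
have e1q : 1 - e1 = q / p by rewrite e1def qdef; field.
have lnqp : ln (q / p) = ln q - ln p by rewrite ln_div.
pose W := expR (q * (ln p - ln q)).
have bE : b = (W - 1) * p.
  by rewrite bdef e1q lnqp e1def invrK /W; congr ((expR _ - 1) * _); ring.
have pE : p = expR (ln p) by rewrite lnK ?posrE.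
have qE : q = expR (ln q) by rewrite lnK ?posrE.
have AE : A = expR (O + ln p - ln q).
  by rewrite Adef LC expRB expRD !lnK ?posrE// invf_div mulrA.
have ln_qp : ln q <= ln p by rewrite ler_ln ?posrE// qdef gerBl.
have A1 : 1 <= A by rewrite AE -expR0 ler_expR; lra.
have W1 : 1 <= W.
  by rewrite /W -expR0 ler_expR mulr_ge0 ?(ltW q0)// subr_ge0.
have AW : 1 + A * b * e1 <= A * W.
  rewrite bE (_ : A * ((W - 1) * p) * e1 = A * (W - 1)); last by rewrite e1def; field.
  lra.
have AW0 : 0 < 1 + A * b * e1.
  rewrite bE (_ : A * ((W - 1) * p) * e1 = A * (W - 1)); last by rewrite e1def; field.
  by rewrite ltr_pwDl// mulr_ge0 ?subr_ge0// (le_trans ler01).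
have lnAW : ln (1 + A * b * e1) <= O + ln p - ln q + q * (ln p - ln q).
  rewrite -[leRHS]expRK expRD -AE -/W ler_ln ?posrE//.
  by rewrite mulr_gt0 ?expR_gt0// AE expR_gt0.
have lny : - ln (e1 / (1 + A * b * e1)) <= ln p + (O + ln p - ln q + q * (ln p - ln q)).
  have lne1 : ln e1 = - ln p by rewrite e1def lnV ?posrE.
  rewrite ln_div ?posrE ?lne1//; first by move: lnAW; lra.
  by rewrite e1def invr_gt0.
have -> : kappa p * C * expR (q * O) =
    p * C * expR (q * (ln p + (O + ln p - ln q + q * (ln p - ln q)))).
  rewrite /kappa /powR (negbTE pn0) -qdef (negbTE qn0) -expRB.
  transitivity (C * expR (p ^+ 2 * ln p - p * q * ln q + q * O)).
    by rewrite (expRD _ (q * O)); ring.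
  rewrite [LHS](_ : _ = C * expR (ln p + q * (ln p + (O + ln p - ln q + q * (ln p - ln q))))).
    by rewrite (expRD (ln p)) lnK ?posrE//; ring.
  by congr (C * expR _); rewrite qdef; ring.
rewrite invfM {1}Ldef invrK -expRN ler_pM2l ?mulr_gt0// ler_expR -mulrN.
by rewrite ler_pM2l.
Qed.

Lemma relative_entropy_ge0 (R : realType) (X : completeMetricType R)
    (nu P : probability (borel X) R) : (0 <= relative_entropy nu P)%E.
Proof.
have [nuP|nuP] := pselect (nu `<< P); last first.
  by rewrite /relative_entropy asboolF// leey.
have [r [mr r0 rnu]] := dominated_density nuP.
rewrite (relative_entropy_density mr r0 rnu).
apply: le_trans (gibbs_le_entropy mr r0 rnu (bm_cst _ 0)).
by rewrite expR0 !int_cst ln1 subr0.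
Qed.

(* Kantorovich duality needs a moment of [nu]: it comes from the dual inequality and Gibbs'
   principle, which bound the integrals of the truncated costs. *)
Lemma dual_transport_entropy (R : realType) (X : completeMetricType R)
    (P : probability (borel X) R) (alpha : R -> R) (k : R) (x0 : X) :
  separable X -> compact_closed_balls X -> young_function alpha -> Delta2 alpha ->
  0 < k -> (\int[P]_x (alpha (mdist (x : X) x0))%:E < +oo)%E ->
  (forall f g : borel X -> R, bounded_measurable f -> bounded_measurable g ->
    (forall x y : X, f x - g y <= alpha (mdist x y)) ->
    ln (\int[P]_x expR (k * f x)) <= k * \int[P]_x g x) ->
  transport_entropy alpha k^-1 P.
Proof.
move=> sX cX Ya D2 k0 Pfin dual nu.
have [nuP|nuP] := pselect (nu `<< P); last first.
  by rewrite /relative_entropy asboolF// mulry gtr0_sg ?invr_gt0// mul1e leey.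
have [r [mr r0 rnu]] := dominated_density nuP.
rewrite (relative_entropy_density mr r0 rnu); set H := (\int[nu]_x _)%E.
have gibbs F := gibbs_le_entropy mr r0 rnu (F := F).
have H0 : (0 <= H)%E by rewrite /H -(relative_entropy_density mr r0 rnu) relative_entropy_ge0.
have [->|Hoo] := eqVneq H +oo%E; first by rewrite mulry gtr0_sg ?invr_gt0// mul1e leey.
have Hfin : H \is a fin_num by rewrite ge0_fin_numE// ltey.
have bound (f g : borel X -> R) : bounded_measurable f -> bounded_measurable g ->
    (forall x y : X, f x - g y <= alpha (mdist x y)) ->
    \int[nu]_x f x - \int[P]_x g x <= k^-1 * fine H.
  move=> bf bg fg; rewrite ler_pdivlMl//.
  have := gibbs _ (bmZ k bf); rewrite -/H -{1}(fineK Hfin) lee_fin intZ//.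
  by have := dual f g bf bg fg; lra.
rewrite -(fineK Hfin) -EFinM; apply: (kantorovich_le (x0 := x0)) => //.
have [K K1 HK] := young_quasi_triangle Ya D2.
have K0 : 0 < K := lt_le_trans ltr01 K1.
have ma := cost_measurable x0 Ya.
have a0 (x : borel X) : 0 <= alpha (mdist (x : X) x0) := young_ge0 Ya _.
pose a (N : nat) (x : borel X) := Num.min N%:R (alpha (mdist (x : X) x0)).
have ba N : bounded_measurable (a N) by exact: bm_minr ma a0.
pose I := fine (\int[P]_x (alpha (mdist (x : X) x0))%:E)%E.
apply: (@integral_lty_of_truncations _ _ _ _ _ (K * (k^-1 * fine H + I))) => // N.
have aI : \int[P]_x a N x <= I.
  apply: le_Rintegral => //; [exact: bm_integrable| |by move=> x _; rewrite ge_min lexx orbT].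
  apply/integrableP; split; first exact/measurable_EFinP.
  by under eq_integral do rewrite /= ger0_norm//.
(* Since [K >= 1], truncation preserves the quasi-triangle inequality, so [K^-1 * a N] and [a N] are
   admissible potentials; they bound the truncated moment of [nu] by its entropy and the moment of
   [P]. *)
have bKa : bounded_measurable (fun x => K^-1 * a N x) by exact: bmZ.
have := bound _ _ bKa (ba N); rewrite intZ// => Hb.
rewrite -ler_pdivrMl// -lerBlDr; apply: le_trans (Hb _); first by rewrite lerB.
move=> x y; rewrite lerBlDr ler_pdivrMl// /a.
have axy : alpha (mdist x x0) <= K * (alpha (mdist x y) + alpha (mdist y x0)).
  apply: le_trans (HK _ _ (mdist_ge0 _ _) (mdist_ge0 _ _)).
  by apply: (young_homo Ya); [exact: mdist_ge0|exact: metric_triangle].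
have [aN|aN] := leP N%:R (alpha (mdist y x0)).
  rewrite ge_min; apply/orP; left.
  apply: (@le_trans _ _ (alpha (mdist x y) + N%:R)); first by rewrite lerDr (young_ge0 Ya).
  by rewrite ler_peMl// addr_ge0// (young_ge0 Ya).
by rewrite ge_min axy orbT.
Qed.

Theorem theorem1p9 (R : realType) (X : completeMetricType R)
    (sepX : separable X) (ballX : compact_closed_balls X)
    (mu : probability (borel X) R) (alpha : R -> R)
    (young_alpha : young_function alpha) (D2_alpha : Delta2 alpha)
    (p_gt1 : 1 < p_exponent alpha)
    (C : R) (C_gt0 : 0 < C) (T_mu : transport_entropy alpha C mu)
    (phi : {mfun borel X >-> R}) (bnd_phi : bounded_fun (phi : borel X -> R^o)) :
  let p := p_exponent alpha in
  transport_entropy alpha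
    (kappa p * C * expR ((p - 1) * Osc phi)) (tilt mu phi).
Proof.
move=> p; have p0 : 0 < p := lt_trans ltr01 p_gt1.
have bphi := bm_phi bnd_phi.
pose q := p - 1; have q0 : 0 < q by rewrite subr_gt0.
pose L := (p * C)^-1; have L0 : 0 < L by rewrite invr_gt0 mulr_gt0.
pose e1 := p^-1; have e10 : 0 < e1 by rewrite invr_gt0.
have e11 : e1 < 1 by rewrite invf_lt1.
have LC : L * C < 1 by rewrite /L invfM -mulrA mulVf ?gt_eqF// mulr1.
pose b := (expR (- q * ln (1 - e1)) - 1) / e1.
have b0 : 0 < b.
  rewrite divr_gt0// subr_gt0 expR_gt1 mulNr oppr_gt0 pmulr_rlt0// ln_lt0//.
  by rewrite subr_gt0 e11 gtrBl.
pose A := expR (Osc phi) / (1 - L * C).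
have A0 : 0 < A by rewrite divr_gt0 ?expR_gt0// subr_gt0.
have O0 : 0 <= Osc phi.
  by rewrite subr_ge0 (le_trans (inf_le_phi bnd_phi point))// phi_le_sup.
pose k := L * expR (q * ln (e1 / (1 + A * b * e1))).
have k0 : 0 < k by rewrite mulr_gt0// expR_gt0.
have growth u v e : 0 <= u -> 0 <= v -> 0 < e -> e <= e1 ->
    alpha (u + v) - alpha u <= b * e * alpha u + expR (- q * ln e) * alpha v.
  by move=> u0 v0 e0 ee1; exact: young_increment_le.
have Tk : transport_entropy alpha k^-1 (tilt mu phi).
  apply: (dual_transport_entropy (x0 := point)) => //.
    (* The moment of [tilt] comes from that of [mu], the density being bounded by [expR M / Z]. *)
    have Z0 := int_expR_gt0 mu bphi.
    have [_ [M HM]] := bphi.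
    apply: (dominated_moment (M := expR M / \int[mu]_x expR (phi x)) _ _ _ _ (tilt_density mu bnd_phi)).
    - by apply: measurable_funM; [exact: (bm_expR bphi).1|exact: measurable_cst].
    - by move=> x; rewrite divr_ge0 ?expR_ge0// ltW.
    - by rewrite divr_ge0 ?expR_ge0// ltW.
    - move=> x; rewrite ler_wpM2r ?invr_ge0 ?(ltW Z0)// ler_expR.
      exact: le_trans (ler_norm _) (HM x).
    - exact: cost_measurable.
    - by move=> x; exact: young_ge0.
    - by apply: (@transport_entropy_moment R X alpha mu C point) => //; exact: ltW.
  move=> f g bf bg fg; have [_ [M fM]] := bf.
  apply: (tau_log_sobolev_dual young_alpha A0 L0 q0 e10 b0 growth _ bf bg fM fg).
  move=> w psi bw bpsi psi0 wpsi.
  by apply: (tilt_tau_log_sobolev bnd_phi sepX young_alpha T_mu) => //; exact: ltW.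
(* Enlarging the constant preserves the inequality because the relative entropy is nonnegative. *)
move=> nu; apply: le_trans (Tk nu) _.
apply: lee_wpmul2r; first exact: relative_entropy_ge0.
by rewrite lee_fin; apply: dual_constant_le.
Qed.
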